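(* For every complex-valued $u\in C_0^\infty(\mathbb{R}^2\setminus\{0\})$ the inequality $$\int_{\mathbb{R}^2}|\nabla_2u|^2\,\log\bigl((e^2|x|)^{-1}\bigr)\,dx\le\mathrm{Re}\int_{\mathbb{R}^2}\Delta^2u\cdot\overline{u}\,\log\bigl(|x|^{-1}\bigr)\,dx$$ holds.
   Context: $C_0^\infty(\mathbb{R}^2\setminus\{0\})$ is the space of infinitely differentiable functions with compact support in $\mathbb{R}^2\setminus\{0\}$. $|\nabla_2u|^2=|u_{x_1x_1}|^2+2|u_{x_1x_2}|^2+|u_{x_2x_2}|^2$. $\Delta^2$ is the biharmonic operator. The weights are $\log\bigl((e^2|x|)^{-1}\bigr)=-2-\log|x|$ and $\log\bigl(|x|^{-1}\bigr)=-\log|x|$. *)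

(* Defs.v *)
From HB Require Import structures.
From mathcomp Require Import all_boot all_order all_algebra.
From mathcomp Require Import all_classical all_reals all_analysis.
From mathcomp Require Export complex.

Set Implicit Arguments.
Unset Strict Implicit.
Unset Printing Implicit Defensive.

Import Order.TTheory GRing.Theory Num.Theory.
Import numFieldNormedType.Exports.

Local Open Scope classical_set_scope.
Local Open Scope complex_scope.
Local Open Scope ring_scope.

Section Plane.
Context {R : realType}.

(* The norm `|x| that the library puts on R * R is the sup norm. *)
Definition enorm (x : R * R) : R := Num.sqrt (x.1 ^+ 2 + x.2 ^+ 2).

Definition e1 : R * R := (1, 0).
Definition e2 : R * R := (0, 1).

Fixpoint Ck_on (k : nat) (Omega : set (R * R)) (f : R * R -> R) : Prop :=
  (forall x, Omega x -> {for x, continuous f}) /\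
  if k is k'.+1 then
    [/\ forall x, Omega x -> derivable f x e1 /\ derivable f x e2,
        Ck_on k' Omega (fun x => 'D_e1 f x) &
        Ck_on k' Omega (fun x => 'D_e2 f x)]
  else True.

Definition smooth_on (Omega : set (R * R)) (u : R * R -> R[i]) : Prop :=
  forall k : nat, Ck_on k Omega (fun x => complex.Re (u x)) /\
                  Ck_on k Omega (fun x => complex.Im (u x)).

Definition supp (u : R * R -> R[i]) : set (R * R) :=
  closure [set x | u x != 0].

(* Elements of C_0^oo(Omega), Omega open, are represented by their extension
   by zero to the whole plane. *)
Definition test_function (Omega : set (R * R)) (u : R * R -> R[i]) : Prop :=
  [/\ smooth_on Omega u, compact (supp u) & supp u `<=` Omega].

(* The library has no topology on R[i]: derivatives and integrals of
   complex-valued functions are taken on real and imaginary parts. *)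
Definition partial (v : R * R) (u : R * R -> R[i]) (x : R * R) : R[i] :=
  'D_v (fun y => complex.Re (u y)) x +i* 'D_v (fun y => complex.Im (u y)) x.

Definition laplacian (u : R * R -> R[i]) (x : R * R) : R[i] :=
  partial e1 (partial e1 u) x + partial e2 (partial e2 u) x.

Definition bilaplacian (u : R * R -> R[i]) : R * R -> R[i] :=
  laplacian (laplacian u).

Definition sq_hessian (u : R * R -> R[i]) (x : R * R) : R :=
  ComplexField.Normc.normc (partial e1 (partial e1 u) x) ^+ 2
  + 2 * ComplexField.Normc.normc (partial e2 (partial e1 u) x) ^+ 2
  + ComplexField.Normc.normc (partial e2 (partial e2 u) x) ^+ 2.

Definition integral2 (f : R * R -> R) : R :=
  (\int[(@lebesgue_measure R \x @lebesgue_measure R)%E]_x f x)%R.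

Definition cintegral2 (f : R * R -> R[i]) : R[i] :=
  integral2 (fun x => complex.Re (f x)) +i*
  integral2 (fun x => complex.Im (f x)).

End Plane.

(* Main.v *)
(* Real and imaginary parts separate, so let u be real; put w = log(1/r), let
   d_t = r d_r, d_theta be the polar derivatives and write u = r h.
   Integrating by parts, and using that w is harmonic off the origin,
     Re int (Delta^2 u) u w - int |D^2 u|^2 w = - int sum_ij u_i u_j w_ij,
   so that the claim becomes
     int (u_r^2 - u_theta^2 / r^2) / r^2 <= 2 int |D^2 u|^2.
   With respect to dt dtheta, r^2 |D^2 u|^2 is
     (h_tt + h_t)^2 + 2 h_ttheta^2 + (h + h_t + h_thetatheta)^2,
   and up to a divergence the difference of the two sides is a sum of squares
   plus h_thetatheta^2 - h_theta^2.  The latter is nonnegative in the mean by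
   Wirtinger's inequality on circles.  To prove that without polar coordinates,
   split u into its parts odd and even under x_2 -> - x_2: if f is odd then
   f_theta - f cot(theta) is square integrable and completing the square gives
   int f^2 <= int f_theta^2.  This applies to f = u_theta when u is even; when
   u is odd it applies to u itself, and combines with
   int (h + h_thetatheta)^2 >= 0. *)

Require Import Defs.
From mathcomp Require Import all_boot all_order all_algebra.
From mathcomp Require Import all_classical all_reals all_analysis.
From mathcomp Require Import ring lra.

Set Implicit Arguments.
Unset Strict Implicit.
Unset Printing Implicit Defensive.

Import Order.TTheory GRing.Theory Num.Theory.
Import numFieldNormedType.Exports.

Local Open Scope classical_set_scope.
Local Open Scope complex_scope.
Local Open Scope ring_scope.

(** * Directional derivatives and mixed partials *)

Section directional.
Context {R : realType}.
Implicit Types (f : R * R -> R) (p : R * R).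

(** An equality of functions of [h], so that existence and value of the derivative both transfer
    between the plane and a coordinate line. *)
Lemma growth_e1 f p :
  (fun h : R => h^-1 *: ((f \o shift p) (h *: e1) - f p)) =
  (fun h : R => h^-1 *: (((fun t => f (t, p.2)) \o shift p.1) (h *: 1) - f (p.1, p.2))).
Proof.
apply/funext => h /=; congr (_ *: (f _ - f _)); last by case: p.
by rewrite /shift /= /e1; case: p => a b /=; congr pair; rewrite /= scaler0 add0r.
Qed.

Lemma growth_e2 f p :
  (fun h : R => h^-1 *: ((f \o shift p) (h *: e2) - f p)) =
  (fun h : R => h^-1 *: (((fun t => f (p.1, t)) \o shift p.2) (h *: 1) - f (p.1, p.2))).
Proof.
apply/funext => h /=; congr (_ *: (f _ - f _)); last by case: p.
by rewrite /shift /= /e1; case: p => a b /=; congr pair; rewrite /= scaler0 add0r.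
Qed.

Lemma is_derive_e1P f p d :
  is_derive p e1 f d <-> is_derive p.1 1 (fun t => f (t, p.2)) d.
Proof.
by split=> -[dx dv]; split; move: dx dv; rewrite /derivable /derive growth_e1.
Qed.

Lemma is_derive_e2P f p d :
  is_derive p e2 f d <-> is_derive p.2 1 (fun t => f (p.1, t)) d.
Proof.
by split=> -[dx dv]; split; move: dx dv; rewrite /derivable /derive growth_e2.
Qed.

Lemma continuous_line1 f y : continuous f -> continuous (fun t => f (t, y)).
Proof.
move=> cf t; apply: (@continuous_comp _ _ _ (fun t => (t, y)) f); last exact: cf.
by apply: (@cvg_pair _ _ _ _ (nbhs t) (nbhs y)); [exact: cvg_id|exact: cvg_cst].
Qed.

Lemma continuous_line2 f x : continuous f -> continuous (fun t => f (x, t)).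
Proof.
move=> cf t; apply: (@continuous_comp _ _ _ (fun t => (x, t)) f); last exact: cf.
by apply: (@cvg_pair _ _ _ _ (nbhs x) (nbhs t)); [exact: cvg_cst|exact: cvg_id].
Qed.

End directional.

Section smooth.
Context {R : realType}.
Implicit Types (f g : R * R -> R) (p : R * R).

Definition smooth f := forall k, Ck_on k setT f.

Lemma smooth_continuous f : smooth f -> continuous f.
Proof. by move=> /(_ 0%N)[cf _] p; exact: cf. Qed.

Lemma smooth_derivable1 f p : smooth f -> derivable f p e1.
Proof. by move=> /(_ 1%N)[_ [/(_ p I)[]]]. Qed.

Lemma smooth_derivable2 f p : smooth f -> derivable f p e2.
Proof. by move=> /(_ 1%N)[_ [/(_ p I)[]]]. Qed.

Lemma smooth_derive1 f : smooth f -> smooth (fun p => 'D_e1 f p).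
Proof. by move=> sf k; have [_ []] := sf k.+1. Qed.

Lemma smooth_derive2 f : smooth f -> smooth (fun p => 'D_e2 f p).
Proof. by move=> sf k; have [_ []] := sf k.+1. Qed.

Lemma smooth_is_derive1 f p : smooth f -> is_derive p e1 f ('D_e1 f p).
Proof. by move=> /smooth_derivable1/derivableP. Qed.

Lemma smooth_is_derive2 f p : smooth f -> is_derive p e2 f ('D_e2 f p).
Proof. by move=> /smooth_derivable2/derivableP. Qed.

Lemma MVT_line (g dg : R -> R) (a h : R) : 0 < h ->
  (forall x : R, is_derive x 1 g (dg x)) ->
  exists2 c, a < c < a + h & g (a + h) - g a = dg c * h.
Proof.
move=> h0 dgP.
have aah : a < a + h by rewrite ltrDl.
have cg : {within `[a, a + h], continuous g}.
  apply: continuous_subspaceT => x.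
  by apply/differentiable_continuous/derivable1_diffP; have [] := dgP x.
have [c] := MVT aah (fun x _ => dgP x) cg.
by rewrite in_itv/= addrAC subrr add0r => ? ?; exists c.
Qed.

(** The mean value theorem is used in [x_1] on the difference of two horizontal restrictions, then
    in [x_2] on ['D_e1 f]; [second_difference21] takes the other order. *)
Lemma second_difference12 f p h : smooth f -> 0 < h ->
  exists q, [/\ p.1 < q.1 < p.1 + h, p.2 < q.2 < p.2 + h &
  f (p.1 + h, p.2 + h) - f (p.1 + h, p.2) - (f (p.1, p.2 + h) - f (p.1, p.2))
    = 'D_e2 (fun x => 'D_e1 f x) q * h * h].
Proof.
move=> sf h0.
have [|c cp ->] := @MVT_line (fun t => f (t, p.2 + h) - f (t, p.2))
  (fun t => 'D_e1 f (t, p.2 + h) - 'D_e1 f (t, p.2)) p.1 h h0.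
  move=> x; apply: is_deriveB.
    exact/(is_derive_e1P f (x, p.2 + h))/smooth_is_derive1.
  exact/(is_derive_e1P f (x, p.2))/smooth_is_derive1.
have [|d dp] := @MVT_line (fun t => 'D_e1 f (c, t))
  (fun t => 'D_e2 (fun x => 'D_e1 f x) (c, t)) p.2 h h0.
  move=> x; apply/(is_derive_e2P (fun q => 'D_e1 f q) (c, x)).
  exact/smooth_is_derive2/smooth_derive1.
by move=> ->; exists (c, d).
Qed.

Lemma second_difference21 f p h : smooth f -> 0 < h ->
  exists q, [/\ p.1 < q.1 < p.1 + h, p.2 < q.2 < p.2 + h &
  f (p.1 + h, p.2 + h) - f (p.1, p.2 + h) - (f (p.1 + h, p.2) - f (p.1, p.2))
    = 'D_e1 (fun x => 'D_e2 f x) q * h * h].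
Proof.
move=> sf h0.
have [|c cp ->] := @MVT_line (fun t => f (p.1 + h, t) - f (p.1, t))
  (fun t => 'D_e2 f (p.1 + h, t) - 'D_e2 f (p.1, t)) p.2 h h0.
  move=> x; apply: is_deriveB.
    exact/(is_derive_e2P f (p.1 + h, x))/smooth_is_derive2.
  exact/(is_derive_e2P f (p.1, x))/smooth_is_derive2.
have [|d dp] := @MVT_line (fun t => 'D_e2 f (t, c))
  (fun t => 'D_e1 (fun x => 'D_e2 f x) (t, c)) p.1 h h0.
  move=> x; apply/(is_derive_e1P (fun q => 'D_e2 f q) (x, c)).
  exact/smooth_is_derive1/smooth_derive2.
by move=> ->; exists (d, c).
Qed.

(** Schwarz's theorem: the second difference over a small square is [h^2] times either mixed partial
    at some point of the square, and both mixed partials are continuous. *)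
Lemma mixed_partials f p : smooth f ->
  'D_e2 (fun x => 'D_e1 f x) p = 'D_e1 (fun x => 'D_e2 f x) p.
Proof.
move=> sf; set F := fun q => 'D_e2 (fun x => 'D_e1 f x) q.
set G := fun q => 'D_e1 (fun x => 'D_e2 f x) q.
have cF : {for p, continuous F}.
  exact/smooth_continuous/smooth_derive2/smooth_derive1.
have cG : {for p, continuous G}.
  exact/smooth_continuous/smooth_derive1/smooth_derive2.
apply/eqP; rewrite -[X in X == _]/(F p) -[X in _ == X]/(G p) -subr_eq0 -normr_le0.
apply/ler_addgt0Pl => e e0; rewrite addr0.
have e20 : 0 < e / 2 by rewrite divr_gt0.
move: cF cG => /cvgrPdist_lt/(_ _ e20) cF /cvgrPdist_lt/(_ _ e20) cG.
have /nbhs_ballP[d /= d0 dP] : nbhs p [set q | `|F p - F q| < e / 2 /\ `|G p - G q| < e / 2].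
  exact: filterI cF cG.
have h0 : 0 < d / 2 by rewrite divr_gt0.
have inb q : p.1 < q.1 < p.1 + d / 2 -> p.2 < q.2 < p.2 + d / 2 -> ball p d q.
  move=> /andP[? ?] /andP[? ?]; split; rewrite /ball/= distrC ger0_norm; lra.
have [q [q1 q2 qE]] := second_difference12 p sf h0.
have [r [r1 r2 rE]] := second_difference21 p sf h0.
have FG : F q = G r.
  apply: (mulIf (lt0r_neq0 h0)); apply: (mulIf (lt0r_neq0 h0)).
  rewrite -[LHS]qE -[RHS]rE; ring.
clear qE rE cF cG; clearbody F G.
have [Fq _] := dP _ (inb _ q1 q2); have [_ Gr] := dP _ (inb _ r1 r2).
have -> : F p - G p = (F p - F q) - (G p - G r) by rewrite FG opprB addrA subrK.
by rewrite (le_trans (ler_normB _ _))// [leRHS]splitr lerD// ltW.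
Qed.

End smooth.

(** * Functions vanishing near the origin and near infinity *)

Section vanishing.
Context {R : realType}.
Implicit Types (f g : R * R -> R) (p : R * R) (d M : R).

(** The strict inequalities make this region open, so a function vanishing on it has vanishing
    derivatives there too. *)
Definition off_annulus d M p := `|p| < d \/ M < `|p|.

Definition vanishes d M f := forall p, off_annulus d M p -> f p = 0.

Lemma near_off_annulus d M p : off_annulus d M p ->
  \forall q \near p, off_annulus d M q.
Proof.
have cn : `|q| @[q --> p] --> `|p| by exact: norm_continuous.
by case=> [/(cvgr_lt _ cn)|/(cvgr_gt _ cn)]; apply: filterS => q; [left|right].
Qed.

Lemma vanishes_is_derive d M f p v : vanishes d M f -> off_annulus d M p ->
  is_derive p v f 0.
Proof.
move=> f0 /near_off_annulus pdM.
have f0p : \near p, cst 0 p = f p by apply: filterS pdM => q /f0 ->.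
exact: (near_eq_is_derive f0p (is_derive_cst _ _ _)).
Qed.

Lemma vanishes_derive d M f v : vanishes d M f -> vanishes d M (fun p => 'D_v f p).
Proof. by move=> f0 p /(vanishes_is_derive v f0)[_]. Qed.

Lemma vanishes_continuous d M f p : vanishes d M f -> off_annulus d M p ->
  {for p, continuous f}.
Proof.
move=> f0 pdM; rewrite /prop_for /continuous_at (f0 p pdM); apply: cvg_near_cst.
by apply: filterS (near_off_annulus pdM) => q /f0.
Qed.

(** Around the origin the function is locally zero. Both assumptions pass to the partial
    derivatives, whence the induction on the order. *)
Lemma smooth_punctured f d M : 0 < d -> vanishes d M f ->
  (forall k, Ck_on k (~` [set (0 : R * R)]) f) -> smooth f.
Proof.
move=> d0 f0 sf k; elim: k f f0 sf => [|k ih] f f0 sf.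
  split=> // p _; have [->|p0] := eqVneq p 0.
    by apply: (vanishes_continuous f0); left; rewrite normr0.
  by have [+ _] := sf 0%N; apply; exact/eqP.
split.
  move=> p _; have [->|p0] := eqVneq p 0.
    by apply: (vanishes_continuous f0); left; rewrite normr0.
  by have [+ _] := sf 0%N; apply; exact/eqP.
split.
- move=> p _; have [->|p0] := eqVneq p 0.
    have od : off_annulus d M 0 by left; rewrite normr0.
    by split; [have [] := vanishes_is_derive e1 f0 od|
               have [] := vanishes_is_derive e2 f0 od].
  by have [_ [+ _ _]] := sf 1%N; apply; exact/eqP.
- apply: ih; first exact: vanishes_derive.
  by move=> j; have [_ []] := sf j.+1.
- apply: ih; first exact: vanishes_derive.
  by move=> j; have [_ []] := sf j.+1.
Qed.

(** Explicit radii stand for compact support off the origin; the same radii serve all derivatives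
    and all products with singular weights. *)
Definition test f := smooth f /\ exists d M, 0 < d /\ vanishes d M f.

Lemma Ck_on_lin k f g c : Ck_on k setT f -> Ck_on k setT g ->
  Ck_on k setT (fun p => f p + c * g p).
Proof.
elim: k f g => [|k ih] f g [cf df] [cg dg]; split=> //.
- by move=> p _; apply: cvgD; [exact: cf|apply: cvgM; [exact: cvg_cst|exact: cg]].
- by move=> p _; apply: cvgD; [exact: cf|apply: cvgM; [exact: cvg_cst|exact: cg]].
have [df0 df1 df2] := df; have [dg0 dg1 dg2] := dg.
have D v p : derivable f p v -> derivable g p v ->
    is_derive p v (fun p => f p + c * g p) ('D_v f p + c * 'D_v g p).
  move=> /derivableP fv /derivableP gv.
  by apply: is_deriveD; exact: (@is_deriveZ _ _ _ g c p v).
split.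
- move=> p _; have [? ?] := df0 p I; have [? ?] := dg0 p I.
  by split; [have [] := D e1 p|have [] := D e2 p].
- rewrite (_ : (fun p => _) = (fun p => 'D_e1 f p + c * 'D_e1 g p)); first exact: ih.
  apply/funext => p; have [? ?] := df0 p I; have [? ?] := dg0 p I.
  by have [] := D e1 p.
- rewrite (_ : (fun p => _) = (fun p => 'D_e2 f p + c * 'D_e2 g p)); first exact: ih.
  apply/funext => p; have [? ?] := df0 p I; have [? ?] := dg0 p I.
  by have [] := D e2 p.
Qed.

Lemma test_lin f g c : test f -> test g -> test (fun p => f p + c * g p).
Proof.
move=> [sf [d1 [M1 [d10 f0]]]] [sg [d2 [M2 [d20 g0]]]]; split.
  by move=> k; exact: Ck_on_lin.
exists (Num.min d1 d2), (Num.max M1 M2); split; first by rewrite lt_min d10.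
move=> p; rewrite /off_annulus lt_min (gt_max _ M1 M2) => H.
rewrite f0 ?g0 ?mulr0 ?addr0//.
  by case: H => /andP[? ?]; [left|right].
by case: H => /andP[? ?]; [left|right].
Qed.

Definition reflect2 p : R * R := (p.1, - p.2).

Lemma reflect2K : involutive reflect2.
Proof. by case=> x y; rewrite /reflect2 /= opprK. Qed.

Lemma norm_reflect2 p : `|reflect2 p| = `|p|.
Proof. by rewrite /reflect2 !prod_normE /= normrN. Qed.

Lemma continuous_reflect2 : continuous reflect2.
Proof.
move=> p; apply: (@cvg_pair _ _ _ _ (nbhs p.1) (nbhs (- p.2))); first exact: cvg_fst.
by apply: cvgN; exact: cvg_snd.
Qed.

Lemma is_derive1_reflect2 f p d : is_derive (reflect2 p) e1 f d ->
  is_derive p e1 (f \o reflect2) d.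
Proof. by move=> /is_derive_e1P ?; exact/is_derive_e1P. Qed.

Lemma is_derive2_reflect2 f p d : is_derive (reflect2 p) e2 f d ->
  is_derive p e2 (f \o reflect2) (- d).
Proof.
move=> /is_derive_e2P /= fd; apply/is_derive_e2P.
have := @is_derive1_comp R (fun t => f (p.1, t)) -%R p.2 d (-1) fd (is_deriveNid _ _).
by rewrite mulrN1.
Qed.

(** The factor [c] is carried for the induction: a derivative along [e2] turns it into [- c]. *)
Lemma Ck_on_reflect2 k c f : Ck_on k setT f ->
  Ck_on k setT (fun p => c * f (reflect2 p)).
Proof.
elim: k c f => [|k ih] c f [cf df].
  split=> // p _; apply: cvgM; first exact: cvg_cst.
  by apply: (continuous_comp (@continuous_reflect2 p)); exact: cf.
split.
  move=> p _; apply: cvgM; first exact: cvg_cst.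
  by apply: (continuous_comp (@continuous_reflect2 p)); exact: cf.
have [df0 df1 df2] := df.
have D1 p : is_derive p e1 (fun p => c * f (reflect2 p)) (c * 'D_e1 f (reflect2 p)).
  have [/derivableP fp _] := df0 (reflect2 p) I.
  have fr := is_derive1_reflect2 fp.
  exact: (@is_deriveZ _ _ _ (f \o reflect2) c p e1).
have D2 p : is_derive p e2 (fun p => c * f (reflect2 p)) (- c * 'D_e2 f (reflect2 p)).
  have [_ /derivableP fp] := df0 (reflect2 p) I.
  have fr := is_derive2_reflect2 fp.
  by rewrite mulNr -mulrN; exact: (@is_deriveZ _ _ _ (f \o reflect2) c p e2).
split.
- by move=> p _; split; [have [] := D1 p|have [] := D2 p].
- rewrite (_ : (fun p => _) = (fun p => c * 'D_e1 f (reflect2 p))).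
    exact: (ih c (fun p => 'D_e1 f p)).
  by apply/funext => p; have [] := D1 p.
- rewrite (_ : (fun p => _) = (fun p => - c * 'D_e2 f (reflect2 p))).
    exact: (ih (- c) (fun p => 'D_e2 f p)).
  by apply/funext => p; have [] := D2 p.
Qed.

Lemma test_reflect2 f : test f -> test (f \o reflect2).
Proof.
move=> [sf [d [M [d0 f0]]]]; split.
  move=> k; have := @Ck_on_reflect2 k 1 f (sf k).
  by congr Ck_on; apply/funext => p; rewrite mul1r.
by exists d, M; split=> // p; rewrite /off_annulus -norm_reflect2; exact: f0.
Qed.

End vanishing.

(** * Differential polynomials in a test function and the weights *)

Section weights.
Context {R : realType}.
Implicit Types (p : R * R).

Definition sqnorm p : R := p.1 ^+ 2 + p.2 ^+ 2.

Definition logw p : R := ln ((enorm p)^-1).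

Lemma sqnorm_gt0 p : p != 0 -> 0 < sqnorm p.
Proof.
case: p => x y; rewrite /sqnorm -[_ != 0]/(~~ ((x == 0) && (y == 0)))/= => xy.
by rewrite lt0r paddr_eq0 ?sqr_ge0// !sqrf_eq0 xy addr_ge0 ?sqr_ge0.
Qed.

(* At the origin both sides are [0], because [0^-1 = 0] and [ln 0 = 0]. *)
Lemma logwE p : logw p = - 2^-1 * ln (sqnorm p).
Proof.
rewrite /logw /enorm -/(sqnorm p).
have [->|p0] := eqVneq p 0.
  by rewrite /sqnorm /= expr0n /= addr0 sqrtr0 invr0 ln0// mulr0.
have s0 := sqnorm_gt0 p0.
have r0 : 0 < Num.sqrt (sqnorm p) by rewrite sqrtr_gt0.
rewrite lnV ?posrE// -[in RHS](sqr_sqrtr (ltW s0)) lnXn// -mulr_natr.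
by field.
Qed.

Lemma ln_expR2_enorm p : p != 0 -> ln ((expR 2 * enorm p)^-1) = logw p - 2.
Proof.
move=> p0; have r0 : 0 < enorm p by rewrite sqrtr_gt0 sqnorm_gt0.
rewrite /logw !lnV ?posrE ?mulr_gt0 ?expR_gt0// lnM ?posrE ?expR_gt0// expRK.
by rewrite opprD addrC.
Qed.

Lemma continuous_sqnorm : continuous sqnorm.
Proof.
move=> p; apply: cvgD; apply: cvgM.
- exact: cvg_fst.
- exact: cvg_fst.
- exact: cvg_snd.
- exact: cvg_snd.
Qed.

Lemma is_derive_sqrD (x c : R) : is_derive x 1 (fun t => t ^+ 2 + c) (2 * x).
Proof.
have xx : is_derive x 1 (fun t : R => t * t) (x *: 1 + x *: 1).
  exact: (@is_deriveM _ _ id id x 1 1 1 (is_derive_id _ _) (is_derive_id _ _)).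
have := @is_deriveD _ _ _ (fun t : R => t * t) (cst c) x 1 _ _ xx (is_derive_cst _ _ _).
move=> /is_derive_eq; apply.
by rewrite /GRing.scale/=; ring.
Qed.

Lemma is_derive_sqnorm1 p : is_derive p e1 sqnorm (2 * p.1).
Proof. by apply/is_derive_e1P; exact: (is_derive_sqrD p.1 (p.2 ^+ 2)). Qed.

Lemma is_derive_sqnorm2 p : is_derive p e2 sqnorm (2 * p.2).
Proof.
apply/is_derive_e2P; have := is_derive_sqrD p.2 (p.1 ^+ 2).
by congr is_derive; apply/funext => t; rewrite addrC.
Qed.

Lemma is_derive1_comp_line1 (g : R -> R) (f : R * R -> R) p dg df :
  is_derive (f p) 1 g dg -> is_derive p e1 f df ->
  is_derive p e1 (g \o f) (dg * df).
Proof.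
case: p => x y gd /is_derive_e1P fd; apply/is_derive_e1P.
exact: (@is_derive1_comp R g (fun t => f (t, y)) x _ _ gd fd).
Qed.

Lemma is_derive1_comp_line2 (g : R -> R) (f : R * R -> R) p dg df :
  is_derive (f p) 1 g dg -> is_derive p e2 f df ->
  is_derive p e2 (g \o f) (dg * df).
Proof.
case: p => x y gd /is_derive_e2P fd; apply/is_derive_e2P.
exact: (@is_derive1_comp R g (fun t => f (x, t)) y _ _ gd fd).
Qed.

Lemma is_derive1_inv (x : R) : x != 0 -> is_derive x 1 GRing.inv (- x ^- 2).
Proof.
move=> x0; have := @is_deriveV _ id x 1 1 x0 (is_derive_id _ _).
by rewrite /GRing.scale/= mulr1; congr is_derive.
Qed.

End weights.

(* [Jet i j] stands for the partial derivative [d_1^i d_2^j f] of the base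
   function, [Log] for [log (1/|x|)], [InvSq] for [1/|x|^2] and [InvReg] for
   [1/(x_2^2 + eps)]; all the fields integrated by parts are of this form. *)
Inductive expr (R : Type) : Type :=
| Cst of R | X1 | X2 | Log | InvSq | InvReg | Jet of nat & nat
| Add of expr R & expr R | Mul of expr R & expr R.
Arguments X1 {R}. Arguments X2 {R}. Arguments Log {R}.
Arguments InvSq {R}. Arguments InvReg {R}. Arguments Jet {R}.

Section differential_polynomials.
Context {R : realType}.
Implicit Types (f : R * R -> R) (p : R * R) (e : expr R).

Fixpoint d1 e : expr R := match e with
  | Cst _ | X2 | InvReg => Cst 0
  | X1 => Cst 1
  | Log => Mul (Cst (-1)) (Mul X1 InvSq)
  | InvSq => Mul (Cst (-2)) (Mul X1 (Mul InvSq InvSq))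
  | Jet i j => Jet i.+1 j
  | Add a b => Add (d1 a) (d1 b)
  | Mul a b => Add (Mul (d1 a) b) (Mul a (d1 b))
  end.

Fixpoint d2 e : expr R := match e with
  | Cst _ | X1 => Cst 0
  | X2 => Cst 1
  | Log => Mul (Cst (-1)) (Mul X2 InvSq)
  | InvSq => Mul (Cst (-2)) (Mul X2 (Mul InvSq InvSq))
  | InvReg => Mul (Cst (-2)) (Mul X2 (Mul InvReg InvReg))
  | Jet i j => Jet i j.+1
  | Add a b => Add (d2 a) (d2 b)
  | Mul a b => Add (Mul (d2 a) b) (Mul a (d2 b))
  end.

(* Expressions vanishing wherever the base function does. *)
Fixpoint ideal e : bool := match e with
  | Jet _ _ => true
  | Add a b => ideal a && ideal b
  | Mul a b => ideal a || ideal b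
  | _ => false
  end.

Lemma ideal_d1 e : ideal e -> ideal (d1 e).
Proof.
elim: e => //= [a iha b ihb /andP[/iha -> /ihb ->] //|a iha b ihb].
by move=> /orP[ia|ib]; [rewrite (iha ia) ia|rewrite (ihb ib) ib !orbT].
Qed.

Lemma ideal_d2 e : ideal e -> ideal (d2 e).
Proof.
elim: e => //= [a iha b ihb /andP[/iha -> /ihb ->] //|a iha b ihb].
by move=> /orP[ia|ib]; [rewrite (iha ia) ia|rewrite (ihb ib) ib !orbT].
Qed.

Definition jet f i j : R * R -> R :=
  iter i (fun g p => 'D_e1 g p) (iter j (fun g p => 'D_e2 g p) f).

Fixpoint eval f (eps : R) e p : R := match e with
  | Cst c => c
  | X1 => p.1
  | X2 => p.2
  | Log => logw p
  | InvSq => (sqnorm p)^-1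
  | InvReg => (p.2 ^+ 2 + eps)^-1
  | Jet i j => jet f i j p
  | Add a b => eval f eps a p + eval f eps b p
  | Mul a b => eval f eps a p * eval f eps b p
  end.

Lemma smooth_jet f i j : smooth f -> smooth (jet f i j).
Proof.
move=> sf; elim: i => [|i ih] /=; last exact: smooth_derive1.
by elim: j => [//|j ih] /=; exact: smooth_derive2.
Qed.

(** In [jet] the derivatives along [e2] act first, so a further one has to be commuted past the [i]
    derivatives along [e1]. *)
Lemma jet_derive2 f i j p : smooth f -> 'D_e2 (jet f i j) p = jet f i j.+1 p.
Proof.
move=> sf; elim: i p => [//|i ih] p.
rewrite [LHS](mixed_partials p (smooth_jet i j sf)) /=.
by congr ('D_ _ _ _); apply/funext => q; exact: ih.
Qed.

Lemma vanishes_jet d M f i j : vanishes d M f -> vanishes d M (jet f i j).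
Proof.
move=> f0; elim: i => [|i ih] /=; last exact: vanishes_derive.
by elim: j => [//|j ih] /=; exact: vanishes_derive.
Qed.

Section evaluation.
Variables (f : R * R -> R) (eps : R).
Hypotheses (tf : test f) (eps0 : 0 < eps).
Local Notation ev := (eval f eps).

Let sf : smooth f. Proof. by case: tf. Qed.

Let reg_gt0 p : 0 < p.2 ^+ 2 + eps.
Proof. by rewrite ltr_wpDl ?sqr_ge0. Qed.

Lemma vanishes_eval d M e : vanishes d M f -> ideal e -> vanishes d M (ev e).
Proof.
move=> f0; elim: e => //=.
- by move=> i j _; exact: vanishes_jet.
- by move=> a iha b ihb /andP[ia ib] p pdM; rewrite iha// ihb// addr0.
- move=> a iha b ihb /orP[ia|ib] p pdM; first by rewrite iha// mul0r.
  by rewrite ihb// mulr0.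
Qed.

Lemma eval_ideal0 e : ideal e -> ev e 0 = 0.
Proof.
case: tf => _ [d [M [d0 f0]]] ie; apply: (vanishes_eval f0 ie).
by left; rewrite normr0.
Qed.

Lemma continuous_eval_punctured e p : p != 0 -> {for p, continuous (ev e)}.
Proof.
move=> p0; elim: e => /=.
- by move=> c; exact: cvg_cst.
- exact: cvg_fst.
- exact: cvg_snd.
- rewrite (_ : (fun _ => _) = (fun p => - 2^-1 * ln (sqnorm p))); last first.
    by apply/funext => q; exact: logwE.
  apply: cvgM; first exact: cvg_cst.
  apply: (continuous_comp (@continuous_sqnorm R p)).
  exact/continuous_ln/sqnorm_gt0.
- by apply: cvgV; [rewrite gt_eqF// sqnorm_gt0|exact: continuous_sqnorm].
- apply: cvgV; first by rewrite gt_eqF.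
  by apply: cvgD; [apply: cvgM; exact: cvg_snd|exact: cvg_cst].
- by move=> i j; exact/smooth_continuous/smooth_jet.
- by move=> a iha b ihb; exact: cvgD.
- by move=> a iha b ihb; exact: cvgM.
Qed.

Lemma continuous_eval e : ideal e -> continuous (ev e).
Proof.
move=> ie p; have [->|p0] := eqVneq p 0; last exact: continuous_eval_punctured.
case: tf => _ [d [M [d0 f0]]]; apply: (vanishes_continuous (vanishes_eval f0 ie)).
by left; rewrite normr0.
Qed.

Lemma is_derive1_eval_punctured e p : p != 0 -> is_derive p e1 (ev e) (ev (d1 e) p).
Proof.
move=> p0; have s0 := sqnorm_gt0 p0; elim: e => /=.
- by move=> c; exact: is_derive_cst.
- by apply/is_derive_e1P; exact: is_derive_id.
- by apply/is_derive_e1P; exact: (is_derive_cst p.2 p.1 1).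
- rewrite (_ : (fun _ => _) = (fun p => - 2^-1 * ln (sqnorm p))); last first.
    by apply/funext => q; exact: logwE.
  have lnd := is_derive1_comp_line1 (is_derive1_ln s0) (is_derive_sqnorm1 p).
  have := @is_deriveZ _ _ _ (@ln R \o @sqnorm R) (- 2^-1) p e1 _ lnd.
  move=> /is_derive_eq; apply.
  by rewrite /GRing.scale/=; field; rewrite gt_eqF.
- have := is_derive1_comp_line1 (is_derive1_inv (lt0r_neq0 s0)) (is_derive_sqnorm1 p).
  move=> /is_derive_eq; apply; field; by rewrite gt_eqF.
- by apply/is_derive_e1P; exact: (is_derive_cst (p.2 ^+ 2 + eps)^-1 p.1 1).
- by move=> i j; exact/smooth_is_derive1/smooth_jet.
- by move=> a iha b ihb; exact: is_deriveD.
- move=> a iha b ihb; have := is_deriveM iha ihb; move=> /is_derive_eq; apply.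
  by rewrite /GRing.scale/=; ring.
Qed.

Lemma is_derive2_eval_punctured e p : p != 0 -> is_derive p e2 (ev e) (ev (d2 e) p).
Proof.
move=> p0; have s0 := sqnorm_gt0 p0; elim: e => /=.
- by move=> c; exact: is_derive_cst.
- by apply/is_derive_e2P; exact: (is_derive_cst p.1 p.2 1).
- by apply/is_derive_e2P; exact: is_derive_id.
- rewrite (_ : (fun _ => _) = (fun p => - 2^-1 * ln (sqnorm p))); last first.
    by apply/funext => q; exact: logwE.
  have lnd := is_derive1_comp_line2 (is_derive1_ln s0) (is_derive_sqnorm2 p).
  have := @is_deriveZ _ _ _ (@ln R \o @sqnorm R) (- 2^-1) p e2 _ lnd.
  move=> /is_derive_eq; apply.
  by rewrite /GRing.scale/=; field; rewrite gt_eqF.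
- have := is_derive1_comp_line2 (is_derive1_inv (lt0r_neq0 s0)) (is_derive_sqnorm2 p).
  move=> /is_derive_eq; apply; field; by rewrite gt_eqF.
- have rd : is_derive p e2 (fun p => p.2 ^+ 2 + eps) (2 * p.2).
    by apply/is_derive_e2P; exact: (is_derive_sqrD p.2 eps).
  have := is_derive1_comp_line2 (is_derive1_inv (lt0r_neq0 (reg_gt0 p))) rd.
  move=> /is_derive_eq; apply; field; exact/lt0r_neq0/reg_gt0.
- move=> i j; rewrite -(jet_derive2 i j p sf).
  exact/smooth_is_derive2/smooth_jet.
- by move=> a iha b ihb; exact: is_deriveD.
- move=> a iha b ihb; have := is_deriveM iha ihb; move=> /is_derive_eq; apply.
  by rewrite /GRing.scale/=; ring.
Qed.

(** Off the origin all atoms are differentiable; near the origin an expression of the ideal is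
    identically zero, whatever values the weights take there. *)
Lemma is_derive1_eval e p : ideal e -> is_derive p e1 (ev e) (ev (d1 e) p).
Proof.
move=> ie; have [->|p0] := eqVneq p 0; last exact: is_derive1_eval_punctured.
rewrite eval_ideal0 ?ideal_d1//; case: tf => _ [d [M [d0 f0]]].
by apply: (vanishes_is_derive _ (vanishes_eval f0 ie)); left; rewrite normr0.
Qed.

Lemma is_derive2_eval e p : ideal e -> is_derive p e2 (ev e) (ev (d2 e) p).
Proof.
move=> ie; have [->|p0] := eqVneq p 0; last exact: is_derive2_eval_punctured.
rewrite eval_ideal0 ?ideal_d2//; case: tf => _ [d [M [d0 f0]]].
by apply: (vanishes_is_derive _ (vanishes_eval f0 ie)); left; rewrite normr0.
Qed.

Lemma derive1_eval e : ideal e -> (fun p => 'D_e1 (ev e) p) = ev (d1 e).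
Proof. by move=> ie; apply/funext => p; have [] := is_derive1_eval p ie. Qed.

Lemma derive2_eval e : ideal e -> (fun p => 'D_e2 (ev e) p) = ev (d2 e).
Proof. by move=> ie; apply/funext => p; have [] := is_derive2_eval p ie. Qed.

(** The ideal is stable under [d1] and [d2], which represent the true derivatives, so all orders
    follow by induction. Membership in the ideal is decided by computation. *)
Lemma test_eval e : ideal e -> test (ev e).
Proof.
move=> ie; split; last first.
  case: tf => _ [d [M [d0 f0]]]; exists d, M; split=> //.
  exact: vanishes_eval.
move=> k; elim: k e ie => [|k ih] e ie; split=> //.
- by move=> p _; exact: continuous_eval.
- by move=> p _; exact: continuous_eval.
split.
- by move=> p _; split; [have [] := is_derive1_eval p ie|have [] := is_derive2_eval p ie].
- by rewrite derive1_eval//; exact/ih/ideal_d1.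
- by rewrite derive2_eval//; exact/ih/ideal_d2.
Qed.

End evaluation.

End differential_polynomials.

(** * Integration over the plane *)

Section measure.
Context {R : realType}.
Implicit Types (f g : R * R -> R).

Local Notation mu := (@lebesgue_measure R).
Local Notation mu2 := (@lebesgue_measure R \x @lebesgue_measure R)%E.

(** An open set is the countable union of the rational open boxes that it contains. *)
Lemma open_measurable2 (U : set (R * R)) : open U -> measurable U.
Proof.
move=> oU.
pose box (q : (rat * rat) * (rat * rat)) : set (R * R) :=
  `]ratr q.1.1, ratr q.1.2[%classic `*` `]ratr q.2.1, ratr q.2.2[%classic.
have -> : U = \bigcup_q (if `[< box q `<=` U >] then box q else set0).
  rewrite eqEsubset; split=> [p Up|p [q _]]; last by case: asboolP => // + ?; apply.
  have /nbhs_ballP[d /= d0 dU] : nbhs p U by exact: open_nbhs_nbhs.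
  have itv x : exists q : rat * rat, x - d < ratr q.1 < x /\ x < ratr q.2 < x + d.
    have xdx : x - d < x by rewrite ltrBlDr ltrDl.
    have xxd : x < x + d by rewrite ltrDl.
    have [q1 q1P] := rat_in_itvoo xdx; have [q2 q2P] := rat_in_itvoo xxd.
    by exists (q1, q2); move: q1P q2P; rewrite !in_itv.
  have [q1 [/andP[? ?] /andP[? ?]]] := itv p.1.
  have [q2 [/andP[? ?] /andP[? ?]]] := itv p.2.
  exists (q1, q2) => //; case: asboolP => [_|].
    by split; rewrite /= in_itv/=; apply/andP.
  case=> r []/=; rewrite !in_itv/= => /andP[? ?] /andP[? ?]; apply: dU.
  by split; rewrite /ball/= ltr_norml; apply/andP; split; lra.
apply: countable_bigcupT_measurable => // q; case: asboolP => // _.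
exact: measurableX.
Qed.

Lemma continuous_measurable2 f : continuous f -> measurable_fun setT f.
Proof.
move=> cf mD; apply: (measurability _ (measurable_realfun.RGenOInfty.measurableE R)) => //.
move=> _ [_ [a ->] <-]; rewrite setTI; apply: open_measurable2.
have /continuousP/(_ `]a, +oo[%classic) := cf; apply.
exact: interval_open.
Qed.

Lemma continuous_vanishing_bounded f (d M : R) : continuous f -> vanishes d M f ->
  exists2 K : R, 0 <= K & forall p, `|f p| <= K.
Proof.
move=> cf f0; have cK : compact (`[-M, M]%classic `*` `[-M, M]%classic : set (R * R)).
  by apply: compact_setX; exact: segment_compact.
have : compact (f @` (`[-M, M]%classic `*` `[-M, M]%classic)).
  by apply: continuous_compact cK; exact: continuous_subspaceT.
move=> /compact_bounded[K [_ KP]].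
exists (`|K| + 1); first by rewrite addr_ge0.
move=> p; have [pM|Mp] := leP `|p| M; last by rewrite f0 ?normr0 ?addr_ge0//; right.
apply: (KP (`|K| + 1)); first by rewrite ltr_pwDr// ler_norm.
exists p => //; move: pM; rewrite prod_normE ge_max !ler_norml => /andP[].
by move=> ? ?; split; rewrite /= in_itv.
Qed.

(** Stated for measurable functions so as to cover also the multiple of an indicator that serves as
    dominating function in [wirtinger_odd]. *)
Lemma measurable_vanishing_integrable f (d M K : R) : measurable_fun setT f ->
  vanishes d M f -> (forall p, `|f p| <= K) -> mu2.-integrable setT (EFin \o f).
Proof.
move=> mf f0 fK.
pose A : set (R * R) := `[-M, M]%classic `*` `[-M, M]%classic.
have mA : measurable A by exact: measurableX.
have iA : mu2.-integrable A (EFin \o f); last first.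
  have := (integrable_mkcond (mu := mu2) (EFin \o f) mA).1 iA.
  apply: eq_integrable => // p _; rewrite patchE; case: ifPn => //= pA.
  rewrite f0//; right; rewrite ltNge; apply: contra pA => pM.
  rewrite inE; move: pM; rewrite prod_normE ge_max !ler_norml => /andP[].
  by move=> ? ?; split; rewrite /= in_itv.
apply: measurable_bounded_integrable => //.
- rewrite [X in (X < _)%E]product_measure1E//= lebesgue_measure_itv/=.
  by case: ifPn => _; rewrite ?mule0// -EFinB -EFinM ltry.
- exact: measurable_funTS.
- by exists K; split; rewrite ?num_real// => L KL p _; exact: le_trans (fK p) (ltW KL).
Qed.

Lemma continuous_vanishing_integrable f (d M : R) : continuous f -> vanishes d M f ->
  mu2.-integrable setT (EFin \o f).
Proof.
move=> cf f0; have [K _ fK] := continuous_vanishing_bounded cf f0.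
by apply: measurable_vanishing_integrable f0 fK; exact: continuous_measurable2.
Qed.

Lemma integral_itv_vanishing (g : R -> R) (M : R) : (forall x : R, M < `|x| -> g x = 0) ->
  (\int[mu]_x (g x)%:E = \int[mu]_(x in `[(- M)%R, M]) (g x)%:E)%E.
Proof.
move=> g0; rewrite [RHS]integral_mkcond; apply: eq_integral => x _.
rewrite patchE; case: ifPn => // xM; rewrite g0// ltNge; apply: contra xM.
by rewrite inE/= in_itv/= ler_norml.
Qed.

Lemma integral_derive_vanishing (G g : R -> R) (M : R) :
  (forall x : R, is_derive x 1 G (g x)) -> continuous g ->
  (forall x : R, M < `|x| -> G x = 0) -> (\int[mu]_x (g x)%:E = 0)%E.
Proof.
(* [N] is positive and strictly beyond [M]: [G] vanishes at both ends of [[-N, N]], and [g] vanishes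
   outside. *)
move=> dG cg G0; pose N := `|M| + 1.
have MN : M < N by rewrite ltr_pwDr// ler_norm.
have N0 : 0 < N by rewrite ltr_wpDl.
have cG : continuous G.
  by move=> x; apply/differentiable_continuous/derivable1_diffP; have [] := dG x.
have G0' x : N <= `|x| -> G x = 0 by move=> Nx; rewrite G0// (lt_le_trans MN).
rewrite (@integral_itv_vanishing _ N); last first.
  move=> x Nx; have [_ <-] := dG x.
  have := @near_eq_derive R _ _ (cst 0) G x 1; rewrite derive_cst => <- //.
  have cn : `|y| @[y --> x] --> `|x| by exact: norm_continuous.
  by apply: filterS (cvgr_gt _ cn _ Nx) => y Ny; rewrite G0'// ltW.
rewrite (@continuous_FTC2 R g G).
- have nN : N <= `|N| by exact: ler_norm.
  by rewrite (G0' N)// (G0' (- N)) ?normrN// sube0.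
- by rewrite gtrN.
- exact: continuous_subspaceT.
- split=> [x _||]; first by have [] := dG x.
    by apply: cvg_at_right_filter; exact: cG.
  by apply: cvg_at_left_filter; exact: cG.
- by move=> x _; rewrite derive1E; have [] := dG x.
Qed.

Lemma test_integrable f : test f -> mu2.-integrable setT (EFin \o f).
Proof.
by move=> [/smooth_continuous cf [d [M [_ f0]]]]; exact: continuous_vanishing_integrable f0.
Qed.

Lemma test_derive1 f : test f -> test (fun p => 'D_e1 f p).
Proof.
move=> [sf [d [M [d0 f0]]]]; split; first exact: smooth_derive1.
by exists d, M; split=> //; exact: vanishes_derive.
Qed.

Lemma test_derive2 f : test f -> test (fun p => 'D_e2 f p).
Proof.
move=> [sf [d [M [d0 f0]]]]; split; first exact: smooth_derive2.
by exists d, M; split=> //; exact: vanishes_derive.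
Qed.

Lemma norm_fst (p : R * R) : `|p.1| <= `|p|.
Proof. by rewrite prod_normE le_max lexx. Qed.

Lemma norm_snd (p : R * R) : `|p.2| <= `|p|.
Proof. by rewrite prod_normE le_max lexx orbT. Qed.

(** By Fubini with [x_1] innermost, since the derivative integrates to zero on each horizontal
    line. *)
Lemma integral2_derive1 f : test f -> integral2 (fun p => 'D_e1 f p) = 0.
Proof.
move=> tf; have [sf [d [M [_ f0]]]] := tf.
rewrite /integral2 /Rintegral -(integral21_prod_meas1 (test_integrable (test_derive1 tf))).
rewrite integral0_eq// => y _; rewrite /fubini_G/=.
apply: (@integral_derive_vanishing (fun x => f (x, y)) (fun x => 'D_e1 f (x, y)) M).
- by move=> x; exact/(is_derive_e1P f (x, y))/smooth_is_derive1.
- exact: (continuous_line1 (f := fun p => 'D_e1 f p) (smooth_continuous (smooth_derive1 sf))).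
- by move=> x Mx; rewrite f0//; right; rewrite (lt_le_trans Mx)// (norm_fst (x, y)).
Qed.

Lemma integral2_derive2 f : test f -> integral2 (fun p => 'D_e2 f p) = 0.
Proof.
move=> tf; have [sf [d [M [_ f0]]]] := tf.
rewrite /integral2 /Rintegral -(integral12_prod_meas1 (test_integrable (test_derive2 tf))).
rewrite integral0_eq// => x _; rewrite /fubini_F/=.
apply: (@integral_derive_vanishing (fun y => f (x, y)) (fun y => 'D_e2 f (x, y)) M).
- by move=> y; exact/(is_derive_e2P f (x, y))/smooth_is_derive2.
- exact: (continuous_line2 (f := fun p => 'D_e2 f p) (smooth_continuous (smooth_derive2 sf))).
- by move=> y My; rewrite f0//; right; rewrite (lt_le_trans My)// (norm_snd (x, y)).
Qed.

(** By Fubini with [x_2] innermost and the substitution [y -> -y] on a symmetric interval. *)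
Lemma integral2_reflect2 f (d M : R) : continuous f -> vanishes d M f ->
  integral2 (f \o reflect2) = integral2 f.
Proof.
move=> cf f0.
have fr0 : vanishes d M (f \o reflect2).
  by move=> p; rewrite /off_annulus -norm_reflect2; exact: f0.
have cfr : continuous (f \o reflect2).
  by move=> p; apply: continuous_comp; [exact: continuous_reflect2|exact: cf].
rewrite /integral2 /Rintegral.
rewrite -(integral12_prod_meas1 (continuous_vanishing_integrable cf f0)).
rewrite -(integral12_prod_meas1 (continuous_vanishing_integrable cfr fr0)).
congr fine; apply: eq_integral => x _; rewrite /fubini_F /=.
pose N := `|M|.
have fx0 y : N < `|y| -> f (x, y) = 0.
  move=> Ny; rewrite f0//; right.
  by rewrite (le_lt_trans (ler_norm M))// (lt_le_trans Ny)// (norm_snd (x, y)).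
rewrite (@integral_itv_vanishing (fun y => f (x, y)) N)//.
rewrite (@integral_itv_vanishing (fun y => f (x, - y)) N); last first.
  by move=> y Ny; rewrite fx0// normrN.
have := @integration_by_substitution_oppr R (fun y => f (x, y)) (- N) N.
rewrite opprK => <- //; first by rewrite ge0_cp// normr_ge0.
exact/continuous_subspaceT/continuous_line2.
Qed.

Lemma integral2D f g : test f -> test g ->
  integral2 (fun p => f p + g p) = integral2 f + integral2 g.
Proof. by move=> /test_integrable ? /test_integrable ?; exact: RintegralD. Qed.

Lemma integral2_ge0 f : (forall p, 0 <= f p) -> 0 <= integral2 f.
Proof. by move=> f0; exact: Rintegral_ge0. Qed.

End measure.

(** * Wirtinger's inequality on circles *)

Section wirtinger.
Context {R : realType}.
Implicit Types (f g : R * R -> R) (e : expr R) (p : R * R) (eps c : R).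

(** Every integration by parts below has this form: two integrands agree up to the divergence of a
    field with components in the ideal. *)
Lemma integral2_eval_div f eps (a b c : expr R) : test f -> 0 < eps ->
  ideal a -> ideal b -> ideal c ->
  integral2 (fun p => eval f eps a p + (eval f eps (d1 b) p + eval f eps (d2 c) p))
  = integral2 (eval f eps a).
Proof.
move=> tf eps0 i0 i1 i2.
have t := test_eval tf eps0.
rewrite !integral2D//; last 4 first.
- exact/t/ideal_d1.
- exact/t/ideal_d2.
- exact: t.
- by apply: (t (Add (d1 b) (d2 c))); rewrite /= ideal_d1// ideal_d2.
rewrite -(derive1_eval eps tf i1) -(derive2_eval tf eps0 i2).
rewrite integral2_derive1; last exact: t.
by rewrite integral2_derive2 ?addr0//; exact: t.
Qed.

(** Integrand identities only have to be checked where [1/|x|^2] is a true inverse; at the origin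
    both sides are zero. *)
Lemma eq_eval_punctured f eps (b c : expr R) : test f -> ideal b -> ideal c ->
  (forall p, p != 0 -> eval f eps b p = eval f eps c p) ->
  eval f eps b = eval f eps c.
Proof.
move=> tf i1 i2 ab; apply/funext => p; have [->|/ab//] := eqVneq p 0.
by rewrite !eval_ideal0.
Qed.

Definition Sq e := Mul e e.
Definition Opp e := Mul (Cst (-1)) e.
(** The angular derivative [d_theta] as an expression; [rot] is its analytic counterpart. *)
Definition Jac e := Add (Mul X1 (d2 e)) (Opp (Mul X2 (d1 e))).

Arguments Jac : simpl never.

Definition rot f p : R := p.1 * 'D_e2 f p - p.2 * 'D_e1 f p.

(** With [f = r h] and [t = log r], the weight [|x|^-4] makes this the integral of [h^2] with
    respect to [dt dtheta]. *)
Definition wnorm2 f : R := integral2 (fun p => (sqnorm p)^-1 ^+ 2 * f p ^+ 2).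

Lemma rot_eval f eps e : test f -> 0 < eps -> ideal e ->
  rot (eval f eps e) = eval f eps (Jac e).
Proof.
move=> tf eps0 ie; apply/funext => p; rewrite /rot.
have [_ ->] := is_derive1_eval eps tf p ie.
have [_ ->] := is_derive2_eval tf eps0 p ie.
by rewrite /=; ring.
Qed.

Lemma test_rot f : test f -> test (rot f).
Proof.
by move=> tf; rewrite (rot_eval (e := Jet 0 0) tf ltr01)//; exact: test_eval.
Qed.

Lemma wnorm2_eval f eps e :
  wnorm2 (eval f eps e) = integral2 (eval f eps (Mul (Sq InvSq) (Sq e))).
Proof. by congr integral2; apply/funext => p; rewrite /= !expr2. Qed.

Lemma test_wsq f : test f -> test (fun p => (sqnorm p)^-1 ^+ 2 * f p ^+ 2).
Proof.
move=> tf; have := @test_eval _ f 1 tf ltr01 (Mul (Sq InvSq) (Sq (Jet 0 0))) isT.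
by congr test; apply/funext => p; rewrite /= !expr2.
Qed.

Lemma sqnorm_reflect2 p : sqnorm (reflect2 p) = sqnorm p.
Proof. by rewrite /sqnorm /= sqrrN. Qed.

Lemma wnorm2_reflect2 f : test f -> wnorm2 (f \o reflect2) = wnorm2 f.
Proof.
move=> tf; have [sw [d [M [_ w0]]]] := test_wsq tf.
rewrite /wnorm2 -[RHS](integral2_reflect2 (smooth_continuous sw) w0).
by congr integral2; apply/funext => p /=; rewrite sqnorm_reflect2.
Qed.

(** The cross terms cancel pointwise, and the reflected function has the same weighted norm as
    [f]. *)
Lemma parallelogram f c : test f -> c ^+ 2 = 1 ->
  wnorm2 (fun p => f p + c * f (reflect2 p)) +
  wnorm2 (fun p => f p + - c * f (reflect2 p)) = wnorm2 f *+ 4.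
Proof.
move=> tf c2; have tr := test_reflect2 tf.
rewrite /wnorm2 -integral2D; last 2 first.
- exact/test_wsq/(test_lin c tf tr).
- exact/test_wsq/(test_lin (- c) tf tr).
have -> : wnorm2 f *+ 4 = (wnorm2 f + wnorm2 (f \o reflect2)) +
    (wnorm2 f + wnorm2 (f \o reflect2)) by rewrite wnorm2_reflect2//; ring.
have ? := test_wsq tf; have ? := test_wsq tr.
have ? : test (fun p => (sqnorm p)^-1 ^+ 2 * f p ^+ 2 +
    (sqnorm p)^-1 ^+ 2 * (f \o reflect2) p ^+ 2).
  by have := test_lin 1 (test_wsq tf) (test_wsq tr); congr test;
    apply/funext => p; rewrite mul1r.
rewrite /wnorm2 -!integral2D//; congr integral2; apply/funext => p /=.
transitivity ((sqnorm p)^-1 ^+ 2 *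
  (2 * f p ^+ 2 + 2 * c ^+ 2 * f (reflect2 p) ^+ 2)); first ring.
rewrite c2; ring.
Qed.

(** The reflection reverses orientation, so [d_theta] exchanges even and odd functions. *)
Lemma rot_reflect2 f c : test f ->
  rot (fun p => f p + c * f (reflect2 p)) =
  (fun p => rot f p + - c * rot f (reflect2 p)).
Proof.
move=> [sf _]; apply/funext => p; rewrite /rot.
have f1 := smooth_is_derive1 p sf; have f2 := smooth_is_derive2 p sf.
have r1 := is_derive1_reflect2 (smooth_is_derive1 (reflect2 p) sf).
have r2 := is_derive2_reflect2 (smooth_is_derive2 (reflect2 p) sf).
have [_ ->] := is_deriveD f1 (@is_deriveZ _ _ _ (f \o reflect2) c p e1 _ r1).
have [_ ->] := is_deriveD f2 (@is_deriveZ _ _ _ (f \o reflect2) c p e2 _ r2).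
rewrite /GRing.scale/=.
move: ('D_e1 f p) ('D_e1 f (reflect2 p)) ('D_e2 f p) ('D_e2 f (reflect2 p)) => *; ring.
Qed.

(** The rotation field [(-x_2, x_1)] is divergence free, so angular derivatives are divergences. *)
Lemma div_rotational f eps F p :
  eval f eps (d1 (Opp (Mul X2 F))) p + eval f eps (d2 (Mul X1 F)) p = eval f eps (Jac F) p.
Proof. by rewrite /=; ring. Qed.

Lemma eval_JacM f eps a b p : eval f eps (Jac (Mul a b)) p =
  eval f eps (Jac a) p * eval f eps b p + eval f eps a p * eval f eps (Jac b) p.
Proof. by rewrite /=; ring. Qed.

Lemma eval_Jac_InvSq f eps p : eval f eps (Jac InvSq) p = 0.
Proof. by rewrite /=; ring. Qed.

Lemma eval_Jac_X1 f eps p : eval f eps (Jac X1) p = - p.2.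
Proof. by rewrite /=; ring. Qed.

Lemma eval_Jac_X2 f eps p : eval f eps (Jac X2) p = p.1.
Proof. by rewrite /=; ring. Qed.

Lemma eval_Jac_InvReg f eps p :
  eval f eps (Jac InvReg) p = - 2 * p.1 * p.2 * (p.2 ^+ 2 + eps)^-1 ^+ 2.
Proof. by rewrite /=; ring. Qed.

Lemma eval_Jac_Cst f eps c p : eval f eps (Jac (Cst c)) p = 0.
Proof. by rewrite /=; ring. Qed.

(* [u^2 = x_2^2 + eps] regularises the positive solution [|sin|] of [u'' = -u]
   and [c = u'/u = x_1 x_2 / u^2]; completing the square in [(Df - c f)^2]
   leaves only the error term below. *)
Lemma wirtinger_error f eps : test f -> 0 < eps ->
  wnorm2 f <= wnorm2 (rot f) + integral2 (fun p => (sqnorm p)^-1 ^+ 2 * f p ^+ 2 *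
    (eps / (p.2 ^+ 2 + eps) + p.1 ^+ 2 * eps / (p.2 ^+ 2 + eps) ^+ 2)).
Proof.
move=> tf eps0; pose f0 : expr R := Jet 0 0; pose K2 : expr R := Sq InvSq.
pose c : expr R := Mul X1 (Mul X2 InvReg).
(* [err] is [|x|^-4 f^2 (1 + c^2 + d_theta c)], whose last factor would be zero for [c = cot theta],
   that is for [eps = 0]. *)
pose err := Mul (Mul K2 (Sq f0))
  (Mul (Cst eps) (Add InvReg (Mul (Sq X1) (Sq InvReg)))).
pose sq := Mul K2 (Sq (Add (Jac f0) (Opp (Mul c f0)))).
pose F := Mul K2 (Mul c (Sq f0)).
have t := test_eval tf eps0.
have -> : integral2 (fun p => (sqnorm p)^-1 ^+ 2 * f p ^+ 2 *
    (eps / (p.2 ^+ 2 + eps) + p.1 ^+ 2 * eps / (p.2 ^+ 2 + eps) ^+ 2))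
    = integral2 (eval f eps err).
  by congr integral2; apply/funext => p; rewrite /= !expr2 invfM; ring.
rewrite (rot_eval (e := f0) tf eps0)// -[f in X in X <= _]/(eval f eps f0).
rewrite !wnorm2_eval -integral2D; [|exact: t..].
have -> : (fun p => eval f eps (Mul K2 (Sq (Jac f0))) p + eval f eps err p) =
    (fun p => eval f eps (Add (Mul K2 (Sq f0)) sq) p +
       (eval f eps (d1 (Opp (Mul X2 F))) p + eval f eps (d2 (Mul X1 F)) p)).
  apply: (@eq_eval_punctured f eps (Add (Mul K2 (Sq (Jac f0))) err)
    (Add (Add (Mul K2 (Sq f0)) sq)
      (Add (d1 (Opp (Mul X2 F))) (d2 (Mul X1 F))))) => //.
  move=> p _.
  have r0 : p.2 ^+ 2 + eps != 0 by rewrite gt_eqF// ltr_wpDl ?sqr_ge0.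
  rewrite -[RHS]/(eval f eps (Add (Mul K2 (Sq f0)) sq) p +
    (eval f eps (d1 (Opp (Mul X2 F))) p + eval f eps (d2 (Mul X1 F)) p)).
  rewrite div_rotational /F /K2 /Sq !(eval_JacM, eval_Jac_InvSq, eval_Jac_X1,
    eval_Jac_X2, eval_Jac_InvReg) /err /sq /Sq /K2.
  by move: (Jac f0) => D; rewrite /=; move: (sqnorm p)^-1 => k; field.
rewrite (@integral2_eval_div f eps (Add (Mul K2 (Sq f0)) sq) (Opp (Mul X2 F)) (Mul X1 F))//.
rewrite -[leLHS]addr0.
rewrite (_ : eval f eps (Add _ sq) = fun p => eval f eps (Mul K2 (Sq f0)) p + eval f eps sq p)//.
rewrite integral2D; [|exact: t..].
rewrite lerD2l; apply: integral2_ge0 => p /=.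
by apply: mulr_ge0; rewrite -expr2 sqr_ge0.
Qed.

(** Expand [0 <= int |x|^-4 (f + f_thetatheta)^2] and integrate the cross term by parts in
    [theta]. *)
Lemma wirtinger_square f : test f ->
  wnorm2 (rot f) *+ 2 <= wnorm2 f + wnorm2 (rot (rot f)).
Proof.
move=> tf; pose f0 : expr R := Jet 0 0; pose K2 : expr R := Sq InvSq.
pose sq := Mul K2 (Sq (Add f0 (Jac (Jac f0)))).
pose F := Mul (Cst (-2)) (Mul K2 (Mul f0 (Jac f0))).
have e0 : (0 : R) < 1 := ltr01; have t := test_eval tf e0.
rewrite -[f]/(eval f 1 f0) !(rot_eval tf e0)// !wnorm2_eval mulr2n.
rewrite -!integral2D; [|exact: t..].
set A := (X in integral2 X <= _).
have -> : (fun p => eval f 1 (Mul (Sq InvSq) (Sq f0)) p +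
     eval f 1 (Mul (Sq InvSq) (Sq (Jac (Jac f0)))) p) =
    (fun p => eval f 1 (Add (Mul (Cst 2) (Mul K2 (Sq (Jac f0)))) sq) p +
       (eval f 1 (d1 (Opp (Mul X2 F))) p + eval f 1 (d2 (Mul X1 F)) p)).
  apply: (@eq_eval_punctured f 1
    (Add (Mul (Sq InvSq) (Sq f0)) (Mul (Sq InvSq) (Sq (Jac (Jac f0)))))
    (Add (Add (Mul (Cst 2) (Mul K2 (Sq (Jac f0)))) sq)
      (Add (d1 (Opp (Mul X2 F))) (d2 (Mul X1 F))))) => //.
  move=> p _.
  rewrite -[RHS]/(eval f 1 (Add (Mul (Cst 2) (Mul K2 (Sq (Jac f0)))) sq) p +
    (eval f 1 (d1 (Opp (Mul X2 F))) p + eval f 1 (d2 (Mul X1 F)) p)).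
  rewrite div_rotational /F /K2 /Sq !(eval_JacM, eval_Jac_InvSq, eval_Jac_Cst) /sq /Sq /K2.
  by move: (Jac (Jac f0)) (Jac f0) => DD D; rewrite /=; ring.
rewrite (@integral2_eval_div f 1 (Add (Mul (Cst 2) (Mul K2 (Sq (Jac f0)))) sq)
  (Opp (Mul X2 F)) (Mul X1 F))//.
rewrite (_ : eval f 1 _ = fun p => A p + eval f 1 sq p); last first.
  apply/funext => p; rewrite -[LHS]/(2 * eval f 1 (Mul K2 (Sq (Jac f0))) p + eval f 1 sq p) /A.
  by rewrite mulr_natl mulr2n.
rewrite integral2D; [| |exact: t]; last first.
  exact: (t (Add (Mul K2 (Sq (Jac f0))) (Mul K2 (Sq (Jac f0))))).
rewrite lerDl; apply: integral2_ge0 => p /=.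
by apply: mulr_ge0; rewrite -expr2 sqr_ge0.
Qed.

End wirtinger.

(** * Removing the regularisation *)

Section wirtinger_limit.
Context {R : realType}.
Implicit Types (f g : R * R -> R) (p : R * R).

Local Notation mu2 := (@lebesgue_measure R \x @lebesgue_measure R)%E.

(** An odd function vanishes on the axis [x_2 = 0]; the mean value theorem in [x_2] then applies
    with a bound [K] for ['D_e2 f]. *)
Lemma odd_test_linear_bound f : test f -> (forall p, f (reflect2 p) = - f p) ->
  exists2 K : R, 0 <= K & forall p, `|f p| <= K * `|p.2|.
Proof.
move=> tf fodd; have [sf [d [M [_ f0]]]] := tf.
have [K K0 fK] := continuous_vanishing_bounded
  (smooth_continuous (smooth_derive2 sf)) (vanishes_derive e2 f0).
exists K => //.
have f_axis x : f (x, 0) = 0.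
  by have := fodd (x, 0); rewrite /reflect2 /= oppr0; lra.
have pos (x y : R) : 0 < y -> `|f (x, y)| <= K * y.
  move=> y0; have [|c _] := @MVT_line R (fun t => f (x, t))
    (fun t => 'D_e2 f (x, t)) 0 y y0.
    by move=> t; exact/(is_derive_e2P f (x, t))/smooth_is_derive2.
  rewrite add0r f_axis subr0 => ->.
  by rewrite normrM (gtr0_norm y0) ler_wpM2r// ltW.
case=> x y /=; have [y0|y0|->] := ltgtP y 0.
- have := fodd (x, - y); rewrite /reflect2 /= opprK => ->.
  by rewrite normrN (ltr0_norm y0); apply: pos; rewrite oppr_gt0.
- by rewrite (gtr0_norm y0); exact: pos.
- by rewrite f_axis !normr0 mulr0.
Qed.

Definition wirtinger_err f eps p : R := (sqnorm p)^-1 ^+ 2 * f p ^+ 2 *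
  (eps / (p.2 ^+ 2 + eps) + p.1 ^+ 2 * eps / (p.2 ^+ 2 + eps) ^+ 2).

Lemma wirtinger_err_ge0 f eps p : 0 < eps -> 0 <= wirtinger_err f eps p.
Proof.
move=> eps0; have r0 : 0 <= p.2 ^+ 2 + eps by rewrite addr_ge0 ?sqr_ge0 ?ltW.
apply: mulr_ge0; first by rewrite mulr_ge0 ?sqr_ge0.
by have e0 := ltW eps0; apply: addr_ge0; apply: divr_ge0; rewrite ?sqr_ge0//;
  apply: mulr_ge0; rewrite ?sqr_ge0.
Qed.

Lemma test_wirtinger_err f eps : test f -> 0 < eps -> test (wirtinger_err f eps).
Proof.
move=> tf eps0; have := @test_eval _ f eps tf eps0
  (Mul (Mul (Sq InvSq) (Sq (Jet 0 0)))
    (Mul (Cst eps) (Add InvReg (Mul (Sq X1) (Sq InvReg))))) isT.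
congr test; apply/funext => p; rewrite /wirtinger_err /= !expr2 invfM; ring.
Qed.

(** On the axis [f] is zero; off it the error is at most a constant, depending on [p], times
    [eps]. *)
Lemma wirtinger_err_cvg f p : (forall q, f (reflect2 q) = - f q) ->
  wirtinger_err f (harmonic n) p @[n --> \oo] --> 0.
Proof.
move=> fodd; have [p20|p20] := eqVneq p.2 0.
  suff -> : (fun n => wirtinger_err f (harmonic n) p) = cst 0 by exact: cvg_cst.
  apply/funext => n; rewrite /wirtinger_err.
  have := fodd p; have -> : reflect2 p = p by rewrite /reflect2 p20 oppr0 -p20; case: p {p20}.
  move=> fp; have -> : f p = 0 by lra.
  by rewrite expr0n /= mulr0 mul0r.
pose C := (sqnorm p)^-1 ^+ 2 * f p ^+ 2 * ((p.2 ^+ 2)^-1 + p.1 ^+ 2 * (p.2 ^+ 2)^-1 ^+ 2).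
have bound h : 0 < h -> wirtinger_err f h p <= C * h.
  move=> h0; have h0' := ltW h0.
  have y0 : 0 < p.2 ^+ 2 by rewrite exprn_even_gt0.
  have ineq : (p.2 ^+ 2 + h)^-1 <= (p.2 ^+ 2)^-1.
    by rewrite lef_pV2 ?posrE ?addr_gt0// lerDl.
  have ineq2 : ((p.2 ^+ 2 + h) ^+ 2)^-1 <= (p.2 ^+ 2)^-1 ^+ 2.
    by rewrite -exprVn lerXn2r ?nnegrE ?invr_ge0 ?addr_ge0// ltW.
  rewrite /wirtinger_err -[leRHS]mulrA.
  apply: ler_wpM2l; first by rewrite mulr_ge0 ?sqr_ge0.
  rewrite mulrDl lerD//; first by rewrite mulrC ler_wpM2r.
  rewrite -mulrA -[leRHS]mulrA; apply: ler_wpM2l; first exact: sqr_ge0.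
  by rewrite mulrC; apply: ler_wpM2r.
have h0 n : 0 < harmonic n :> R by rewrite invr_gt0.
apply: (@squeeze_cvgr _ _ _ _ (cst 0) (fun n => C * harmonic n)).
- by near=> n; rewrite wirtinger_err_ge0//= bound.
- exact: cvg_cst.
- by rewrite -[0](mulr0 C); apply: cvgM; [exact: cvg_cst|exact: cvg_harmonic].
Unshelve. all: by end_near. Qed.

Lemma wirtinger_err_bounded f : test f -> (forall q, f (reflect2 q) = - f q) ->
  exists2 C : R, 0 <= C & forall eps p, 0 < eps -> wirtinger_err f eps p <= C.
Proof.
move=> tf fodd; have [K K0 fK] := odd_test_linear_bound tf fodd.
have [sf [d [M [d0 f0]]]] := tf.
have [L L0 fL] := continuous_vanishing_bounded (smooth_continuous sf) f0.
(* [d^-4] bounds the weight. [L^2] bounds the first term as [eps / (x_2^2 + eps) <= 1]. [M^2 K^2]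
   bounds the second, by [x_1^2 <= M^2], [f^2 <= K^2 x_2^2] and [x_2^2 eps <= (x_2^2 + eps)^2]. *)
exists ((d ^+ 2)^-1 ^+ 2 * (L ^+ 2 + M ^+ 2 * K ^+ 2)).
  apply: mulr_ge0; first exact: sqr_ge0.
  by apply: addr_ge0; [|apply: mulr_ge0]; exact: sqr_ge0.
move=> eps p eps0.
have C0 : 0 <= (d ^+ 2)^-1 ^+ 2 * (L ^+ 2 + M ^+ 2 * K ^+ 2).
  apply: mulr_ge0; first exact: sqr_ge0.
  by apply: addr_ge0; [|apply: mulr_ge0]; exact: sqr_ge0.
have [pd|dp] := ltP `|p| d.
  by rewrite /wirtinger_err f0 ?expr0n/= ?mulr0 ?mul0r//; left.
have [Mp|pM] := ltP M `|p|.
  by rewrite /wirtinger_err f0 ?expr0n/= ?mulr0 ?mul0r//; right.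
have r0 : 0 < p.2 ^+ 2 + eps by rewrite ltr_wpDl ?sqr_ge0.
have f2L : f p ^+ 2 <= L ^+ 2.
  by rewrite -[X in X <= _]real_normK ?num_real// lerXn2r ?nnegrE.
have f2K : f p ^+ 2 <= K ^+ 2 * p.2 ^+ 2.
  rewrite -[X in X <= _]real_normK ?num_real// -[p.2 ^+ 2]real_normK ?num_real//.
  by rewrite -exprMn lerXn2r ?nnegrE ?mulr_ge0.
have p1M : p.1 ^+ 2 <= M ^+ 2.
  rewrite -[X in X <= _]real_normK ?num_real// lerXn2r ?nnegrE//.
    by rewrite (le_trans _ pM).
  by rewrite (le_trans (norm_fst p)).
(* The coordinate realising the sup norm is enough to bound the Euclidean norm from below. *)
have d2s : d ^+ 2 <= sqnorm p.
  have [H|H] := leP `|p.1| `|p.2|.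
    have : `|p| <= `|p.2| by rewrite prod_normE ge_max H lexx.
    move=> /(le_trans dp) dp2; rewrite /sqnorm.
    rewrite (@le_trans _ _ (p.2 ^+ 2)) ?lerDr ?sqr_ge0//.
    by rewrite -[p.2 ^+ 2]real_normK ?num_real// lerXn2r ?nnegrE// ltW.
  have : `|p| <= `|p.1| by rewrite prod_normE ge_max lexx ltW.
  move=> /(le_trans dp) dp2; rewrite /sqnorm.
  rewrite (@le_trans _ _ (p.1 ^+ 2)) ?lerDl ?sqr_ge0//.
  by rewrite -[p.1 ^+ 2]real_normK ?num_real// lerXn2r ?nnegrE// ltW.
have dd : 0 < d ^+ 2 by rewrite exprn_gt0.
have r0' := ltW r0; have e0 := ltW eps0.
rewrite /wirtinger_err -mulrA; apply: ler_pM.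
- exact: sqr_ge0.
- apply: mulr_ge0; first exact: sqr_ge0.
  by apply: addr_ge0; apply: divr_ge0; rewrite ?sqr_ge0//;
  apply: mulr_ge0; rewrite ?sqr_ge0.
- rewrite lerXn2r ?nnegrE ?invr_ge0 ?(ltW dd) ?(le_trans (ltW dd))//.
  by rewrite lef_pV2// posrE (lt_le_trans dd).
rewrite mulrDr lerD//.
  rewrite -[leRHS]mulr1 ler_pM ?sqr_ge0//; first by rewrite divr_ge0 ?ltW.
  by rewrite ler_pdivrMr// mul1r lerDr sqr_ge0.
rewrite mulrA ler_pdivrMr ?exprn_gt0//.
have h : p.2 ^+ 2 * eps <= (p.2 ^+ 2 + eps) ^+ 2.
  have := sqr_ge0 p.2; move: (p.2 ^+ 2) => y y0; rewrite -subr_ge0.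
  rewrite (_ : _ - _ = y ^+ 2 + eps * y + eps ^+ 2); last ring.
  by rewrite !addr_ge0 ?sqr_ge0// mulr_ge0.
rewrite (_ : f p ^+ 2 * _ = (p.1 ^+ 2 * f p ^+ 2) * eps); last ring.
apply: (@le_trans _ _ (M ^+ 2 * K ^+ 2 * (p.2 ^+ 2 * eps))).
  rewrite [leRHS]mulrA ler_wpM2r ?(ltW eps0)// -mulrA.
  by rewrite ler_pM ?sqr_ge0.
by rewrite ler_wpM2l// mulr_ge0 ?sqr_ge0.
Qed.

(** Dominated convergence in [wirtinger_error] along [eps = 1/(n+1)], with the uniform bound [C]
    times the indicator of a square as dominating function. *)
Lemma wirtinger_odd f : test f -> (forall q, f (reflect2 q) = - f q) ->
  wnorm2 f <= wnorm2 (rot f).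
Proof.
move=> tf fodd; have [C C0 errC] := wirtinger_err_bounded tf fodd.
have h0 n : 0 < harmonic n :> R by rewrite invr_gt0.
have [sf [d [M [d0 f0]]]] := tf.
have err0 eps : vanishes d M (wirtinger_err f eps).
  by move=> p pdM; rewrite /wirtinger_err f0// expr0n/= mulr0 mul0r.
pose A : set (R * R) := `[-M, M]%classic `*` `[-M, M]%classic.
have mA : measurable A by exact: measurableX.
pose g p := C * \1_A p : R.
have gC p : wirtinger_err f (harmonic 0) p <= C by exact: errC.
have notA p : p \notin A -> M < `|p|.
  move=> pA; rewrite ltNge; apply: contra pA => pM.
  rewrite inE; move: pM; rewrite prod_normE ge_max !ler_norml => /andP[].
  by move=> ? ?; split; rewrite /= in_itv.
have ig : mu2.-integrable setT (EFin \o g).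
  apply: (@measurable_vanishing_integrable _ g 0 M C).
  - by apply: measurable_realfun.measurable_funM => //;
      exact: measurable_realfun.measurable_indic.
  - move=> p [|Mp]; first by rewrite ltNge normr_ge0.
    rewrite /g indicE; case: (boolP (p \in A)); rewrite ?mulr0//.
    rewrite inE => -[]; rewrite /= !in_itv/= -!ler_norml => p1 p2.
    by move: Mp; rewrite ltNge prod_normE ge_max p1 p2.
  - move=> p; rewrite /g indicE; case: (p \in A); rewrite ?mulr1 ?mulr0 ?normr0//.
    by rewrite ger0_norm.
have terr n := test_wirtinger_err tf (h0 n).
have [|||||] := @dominated_convergence _ _ R mu2 setT measurableT
  (fun n p => (wirtinger_err f (harmonic n) p)%:E) (cst 0%E) (EFin \o g).
- by move=> n; have /integrableP[] := test_integrable (terr n).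
- exact: measurable_cst.
- apply: aeW => p _; apply: cvg_EFin; first exact: nearW.
  exact: wirtinger_err_cvg.
- exact: ig.
- apply: aeW => p n _ /=; rewrite lee_fin ger0_norm ?wirtinger_err_ge0// /g indicE.
  case: (boolP (p \in A)) => [_|/notA Mp]; first by rewrite mulr1 errC.
  by rewrite err0 ?mulr0//; right.
move=> _ _; rewrite integral_cst//= mul0e => cvg0.
(* The difference of the two norms is below every error integral, hence below their limit zero. *)
rewrite -subr_le0 -lee_fin; apply: (cvge_to_ge cvg0); apply: nearW => n /=.
have fin : (\int[mu2]_p (wirtinger_err f (harmonic n) p)%:E)%E \is a fin_num.
  exact: (integrable_fin_num measurableT (test_integrable (terr n))).
rewrite -(fineK fin) lee_fin lerBlDl.
exact: (wirtinger_error tf (h0 n)).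
Qed.

Lemma le_of_double_le (x y z : R) : x <= y -> y *+ 2 <= x + z -> y <= z.
Proof. by rewrite mulr2n; lra. Qed.

Lemma le_of_parallelogram (a b c d x y : R) : a <= c -> b <= d ->
  b + a = x *+ 4 -> c + d = y *+ 4 -> x <= y.
Proof. lra. Qed.

Lemma wirtinger_rot f : test f -> wnorm2 (rot f) <= wnorm2 (rot (rot f)).
Proof.
move=> tf; have tr := test_reflect2 tf.
pose fp c p := f p + c * f (reflect2 p).
have tp c : test (fp c) by exact: test_lin.
have rotp c : rot (fp c) = (fun p => rot f p + - c * rot f (reflect2 p)).
  exact: rot_reflect2.
have rrotp c : rot (rot (fp c)) = (fun p => rot (rot f) p + c * rot (rot f) (reflect2 p)).
  by rewrite rotp (rot_reflect2 _ (test_rot tf)) opprK.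
(* [fp 1] and [fp (-1)] are twice the even and odd parts. The angular derivative of the even one is
   odd. *)
have even : wnorm2 (rot (fp 1)) <= wnorm2 (rot (rot (fp 1))).
  apply: wirtinger_odd; first exact/test_rot.
  by move=> q; rewrite rotp reflect2K; ring.
(* For the odd one, [|f|^2 <= |f_theta|^2] and [2 |f_theta|^2 <= |f|^2 + |f_thetatheta|^2]
   combine. *)
have odd : wnorm2 (rot (fp (-1))) <= wnorm2 (rot (rot (fp (-1)))).
  have square := wirtinger_square (tp (-1)).
  have odd0 : wnorm2 (fp (-1)) <= wnorm2 (rot (fp (-1))).
    by apply: wirtinger_odd => // q; rewrite /fp reflect2K; ring.
  exact: (le_of_double_le odd0 square).
have P1 : wnorm2 (rot (fp (-1))) + wnorm2 (rot (fp 1)) = wnorm2 (rot f) *+ 4.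
  rewrite (rotp (-1)) (rotp 1) opprK.
  exact: (parallelogram (test_rot tf) (expr1n R 2)).
have P2 : wnorm2 (rot (rot (fp 1))) + wnorm2 (rot (rot (fp (-1)))) =
    wnorm2 (rot (rot f)) *+ 4.
  rewrite (rrotp (-1)) (rrotp 1).
  exact: (parallelogram (test_rot (test_rot tf)) (expr1n R 2)).
exact: (le_of_parallelogram even odd P1 P2).
Qed.

End wirtinger_limit.

(** * The integrand identities *)

Section identity.
Context {R : realType}.
Variable f : R * R -> R.
Implicit Types (e F : expr R) (p : R * R).

Local Notation ev := (eval f 1).

(** The Euler operator [r d_r], that is [d_t] for [t = log r]. *)
Definition Eul e := Add (Mul X1 (d1 e)) (Mul X2 (d2 e)).
Arguments Eul : simpl never.
Local Arguments jet : simpl never.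

Definition Div F1 F2 : expr R := Add (d1 F1) (d2 F2).

Definition uJ : expr R := Jet 0 0.
Definition lapJ : expr R := Add (Jet 2 0) (Jet 0 2).
Definition hessJ : expr R :=
  Add (Sq (Jet 2 0)) (Add (Mul (Cst 2) (Sq (Jet 1 1))) (Sq (Jet 0 2))).
Definition gradLogJ : expr R := Add (Mul (d1 uJ) (d1 Log)) (Mul (d2 uJ) (d2 Log)).

(* [Q = sum_{i,j} u_i u_j d_ij log(1/|x|)] in terms of [r d_r u] and [d_theta u] *)
Definition quadJ : expr R := Mul (Sq InvSq) (Add (Sq (Eul uJ)) (Opp (Sq (Jac uJ)))).

(** With [w = log (1/|x|)], [V1] and [V2] form the field of Green's second identity for [Delta u]
    and [u w]. *)
Definition V1 : expr R := Add (Mul (d1 lapJ) (Mul uJ Log)) (Opp (Mul lapJ (d1 (Mul uJ Log)))).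
Definition V2 : expr R := Add (Mul (d2 lapJ) (Mul uJ Log)) (Opp (Mul lapJ (d2 (Mul uJ Log)))).

(** As [w] is harmonic off the origin, [Delta (u w) = w Delta u + 2 grad u . grad w]. *)
Lemma bilaplacian_identity p : p != 0 ->
  (ev (d1 (d1 lapJ)) p + ev (d2 (d2 lapJ)) p) * ev uJ p * ev Log p =
  ev Log p * ev lapJ p ^+ 2 + 2 * ev lapJ p * ev gradLogJ p + ev (Div V1 V2) p.
Proof.
move=> /sqnorm_gt0/lt0r_neq0 s0.
(* The Laplacian is abstracted so that its derivatives remain atoms; this equation keeps its link
   with the second derivatives produced by [Delta (u w)]. *)
have : ev lapJ p = jet f 2 0 p + jet f 0 2 p by [].
rewrite /Div /V1 /V2; move: lapJ => L; rewrite /gradLogJ /=.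
move: s0; rewrite /sqnorm; move: (logw p) (ev L p) (ev (d1 L) p) (ev (d2 L) p).
move: (ev (d1 (d1 L)) p) (ev (d2 (d2 L)) p) (jet f 0 0 p) (jet f 1 0 p) (jet f 0 1 p).
move: (jet f 2 0 p) (jet f 0 2 p) p.1 p.2 => *; subst; by field.
Qed.

Definition U1 : expr R :=
  Add (Mul Log (Add (Mul (Jet 1 0) (Jet 0 2)) (Opp (Mul (Jet 0 1) (Jet 1 1)))))
  (Mul (Jet 1 0) gradLogJ).
Definition U2 : expr R :=
  Add (Mul Log (Add (Mul (Jet 0 1) (Jet 2 0)) (Opp (Mul (Jet 1 0) (Jet 1 1)))))
  (Mul (Jet 0 1) gradLogJ).

(** Uses [(Delta u)^2 = |D^2 u|^2 + 2 det D^2 u]: the divergence of [U1], [U2] is [2 w det D^2 u + 2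
    Delta u (grad u . grad w) + Q]. *)
Lemma hessian_identity p : p != 0 ->
  ev Log p * ev lapJ p ^+ 2 + 2 * ev lapJ p * ev gradLogJ p =
  ev Log p * ev hessJ p - ev quadJ p + ev (Div U1 U2) p.
Proof.
move=> /sqnorm_gt0/lt0r_neq0 s0; rewrite /= /sqnorm.
move: s0; rewrite /sqnorm; move: (logw p).
move: (jet f 1 0 p) (jet f 0 1 p) (jet f 2 0 p) (jet f 1 1 p) (jet f 0 2 p).
move: (jet f 3 0 p) (jet f 2 1 p) (jet f 1 2 p) (jet f 0 3 p).
move: p.1 p.2 => *; by field.
Qed.

(** The field [x] has divergence 2 and [|x|^-4] is homogeneous of degree -4, which gives the
    coefficient [2 - 4 = -2]. *)
Lemma div_radial F p : p != 0 ->
  ev (Div (Mul X1 (Mul (Sq InvSq) F)) (Mul X2 (Mul (Sq InvSq) F))) p =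
  ev (Sq InvSq) p * (ev (Eul F) p - 2 * ev F p).
Proof.
move=> /sqnorm_gt0/lt0r_neq0; rewrite /= /sqnorm.
move: (ev F p) (ev (d1 F) p) (ev (d2 F) p) p.1 p.2 => *; by field.
Qed.

(** The three squared brackets are [r^2] times the entries of the Hessian in the orthonormal polar
    frame. *)
Lemma hessian_polar p : p != 0 -> ev hessJ p = ev (Sq InvSq) p *
  ((ev (Eul (Eul uJ)) p - ev (Eul uJ) p) ^+ 2 +
   2 * (ev (Jac (Eul uJ)) p - ev (Jac uJ) p) ^+ 2 +
   (ev (Eul uJ) p + ev (Jac (Jac uJ)) p) ^+ 2).
Proof.
move=> /sqnorm_gt0/lt0r_neq0; rewrite /= /sqnorm.
move: (jet f 1 0 p) (jet f 0 1 p) (jet f 2 0 p) (jet f 1 1 p) (jet f 0 2 p).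
move: p.1 p.2 => *; by field.
Qed.

Lemma eval_EulM a b p : ev (Eul (Mul a b)) p =
  ev (Eul a) p * ev b p + ev a p * ev (Eul b) p.
Proof. by rewrite /=; ring. Qed.

Lemma eval_EulD a b p : ev (Eul (Add a b)) p = ev (Eul a) p + ev (Eul b) p.
Proof. by rewrite /=; ring. Qed.

Lemma eval_Eul_Cst c p : ev (Eul (Cst c)) p = 0.
Proof. by rewrite /=; ring. Qed.

Lemma eval_JacD a b p : ev (Jac (Add a b)) p = ev (Jac a) p + ev (Jac b) p.
Proof. by rewrite /=; ring. Qed.

(** Dilations commute with rotations. *)
Lemma eval_Eul_Jac p : ev (Eul (Jac uJ)) p = ev (Jac (Eul uJ)) p.
Proof.
rewrite /=; move: (jet f 1 0 p) (jet f 0 1 p) (jet f 2 0 p) (jet f 1 1 p) (jet f 0 2 p).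
by move: p.1 p.2 => *; ring.
Qed.

(** With [u = r h], [radJ] is [r^2 (h^2 - 2 h_theta^2)] and [angJ] is [r^2 h_theta (2 h + 4 h_t)];
    they are the [t] and [theta] components of the field whose divergence is split off. *)
Definition radJ : expr R := Add (Sq uJ) (Mul (Cst (-2)) (Sq (Jac uJ))).
Definition angJ : expr R := Mul (Jac uJ) (Add (Mul (Cst 4) (Eul uJ)) (Mul (Cst (-2)) uJ)).

Definition Z1 : expr R :=
  Add (Mul X1 (Mul (Sq InvSq) radJ)) (Opp (Mul X2 (Mul (Sq InvSq) angJ))).
Definition Z2 : expr R :=
  Add (Mul X2 (Mul (Sq InvSq) radJ)) (Mul X1 (Mul (Sq InvSq) angJ)).

(** With respect to [dt dtheta] this is [2 (h_tt + h_t)^2 + 4 h_ttheta^2 + h_t^2 + (h +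
    h_thetatheta)^2]. *)
Definition sosJ : expr R := Mul (Sq InvSq)
  (Add (Mul (Cst 2) (Sq (Add (Eul (Eul uJ)) (Opp (Eul uJ)))))
  (Add (Mul (Cst 4) (Sq (Add (Jac (Eul uJ)) (Opp (Jac uJ)))))
  (Add (Sq (Add (Eul uJ) (Opp uJ))) (Sq (Add uJ (Jac (Jac uJ))))))).

Lemma eval_Eul_radial u J p : ev (Eul (Add (Sq u) (Mul (Cst (-2)) (Sq J)))) p =
  2 * ev u p * ev (Eul u) p - 4 * ev J p * ev (Eul J) p.
Proof. by rewrite eval_EulD !eval_EulM eval_Eul_Cst /=; ring. Qed.

Lemma eval_Jac_angular u J E p :
  ev (Jac (Mul (Sq InvSq) (Mul J (Add (Mul (Cst 4) E) (Mul (Cst (-2)) u))))) p =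
  ev (Sq InvSq) p * (ev (Jac J) p * (4 * ev E p - 2 * ev u p) +
    ev J p * (4 * ev (Jac E) p - 2 * ev (Jac u) p)).
Proof.
by rewrite !eval_JacM eval_JacD !eval_JacM !eval_Jac_Cst eval_Jac_InvSq /=; ring.
Qed.

(* With [u = r h] and [t = log r]: completing squares in the variables
   [(t, theta)] leaves [h_thetatheta^2 - h_theta^2], which is nonnegative
   only after integration over circles. *)
Lemma polar_identity p : p != 0 ->
  2 * ev hessJ p - ev quadJ p = ev sosJ p + ev (Mul (Sq InvSq) (Sq (Jac (Jac uJ)))) p
    - ev (Mul (Sq InvSq) (Sq (Jac uJ))) p + ev (Div Z1 Z2) p.
Proof.
move=> p0; rewrite hessian_polar//.
have -> : ev (Div Z1 Z2) p =
    ev (Div (Mul X1 (Mul (Sq InvSq) radJ)) (Mul X2 (Mul (Sq InvSq) radJ))) p +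
    (ev (d1 (Opp (Mul X2 (Mul (Sq InvSq) angJ)))) p +
     ev (d2 (Mul X1 (Mul (Sq InvSq) angJ))) p).
  rewrite /Z1 /Z2; move: (Mul (Sq InvSq) radJ) (Mul (Sq InvSq) angJ) => A B.
  by rewrite /=; ring.
rewrite div_radial// div_rotational /radJ /angJ eval_Eul_radial eval_Jac_angular.
rewrite eval_Eul_Jac /quadJ /sosJ /Sq /Opp.
move: (Eul (Eul uJ)) (Jac (Jac uJ)) (Jac (Eul uJ)) (Eul uJ) (Jac uJ) => EE JJ JE E J.
rewrite /=; move: (ev EE p) (ev JJ p) (ev JE p) (ev E p) (ev J p) (jet f 0 0 p) (sqnorm p)^-1 => *.
ring.
Qed.

Definition bilapJ : expr R := Add (d1 (d1 lapJ)) (d2 (d2 lapJ)).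

Lemma real_inequality : test f ->
  integral2 (ev (Mul hessJ (Add Log (Cst (-2))))) <=
  integral2 (ev (Mul (Mul bilapJ uJ) Log)).
Proof.
move=> tf; have t := test_eval tf (@ltr01 R).
pose W1 : expr R := Mul (Sq InvSq) (Sq (Jac uJ)).
pose W2 : expr R := Mul (Sq InvSq) (Sq (Jac (Jac uJ))).
pose A : expr R := Mul hessJ (Add Log (Cst (-2))).
pose F1 : expr R := Add V1 (Add U1 Z1).
pose F2 : expr R := Add V2 (Add U2 Z2).
have key : integral2 (ev (Add (Mul (Mul bilapJ uJ) Log) W1)) =
    integral2 (ev (Add (Add A sosJ) W2)).
  rewrite -(@integral2_eval_div _ f 1 (Add (Add A sosJ) W2) F1 F2)//.
  congr integral2.
  apply: (@eq_eval_punctured _ f 1 _ (Add (Add (Add A sosJ) W2) (Div F1 F2))) => // p p0.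
  have B := bilaplacian_identity p0; have H := hessian_identity p0.
  have P := polar_identity p0.
  rewrite -[LHS]/((ev (d1 (d1 lapJ)) p + ev (d2 (d2 lapJ)) p) * ev uJ p * ev Log p + ev W1 p).
  rewrite -[RHS]/(ev hessJ p * (ev Log p + (-2)) + ev sosJ p + ev W2 p +
    ((ev (d1 V1) p + (ev (d1 U1) p + ev (d1 Z1) p)) +
     (ev (d2 V2) p + (ev (d2 U2) p + ev (d2 Z2) p)))).
  rewrite B H; rewrite -/W1 -/W2 in P.
  move: P; rewrite -[ev (Div Z1 Z2) p]/(ev (d1 Z1) p + ev (d2 Z2) p).
  rewrite -[ev (Div V1 V2) p]/(ev (d1 V1) p + ev (d2 V2) p).
  rewrite -[ev (Div U1 U2) p]/(ev (d1 U1) p + ev (d2 U2) p).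
  move: (ev Log p) (ev hessJ p) (ev quadJ p) (ev sosJ p) (ev W1 p) (ev W2 p).
  move: (ev (d1 V1) p) (ev (d2 V2) p) (ev (d1 U1) p) (ev (d2 U2) p) (ev (d1 Z1) p) (ev (d2 Z2) p).
  move=> v1 v2 u1 u2 z1 z2 w h q s a b P.
  (* [polar_identity] is solved for [Q], which cancels the whole contribution of the constant -2. *)
  have -> : q = 2 * h - (s + b - a + (z1 + z2)) by rewrite -P; ring.
  ring.
have rotE : rot f = ev (Jac uJ) by rewrite -[f in LHS]/(ev uJ) rot_eval.
have rrotE : rot (rot f) = ev (Jac (Jac uJ)) by rewrite rotE rot_eval.
have wir := wirtinger_rot tf; rewrite rrotE rotE !wnorm2_eval -/W1 -/W2 in wir.
have tA : test (ev A) by exact: t.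
have tL : test (ev (Mul (Mul bilapJ uJ) Log)) by exact: t.
have tS : test (ev sosJ) by exact: t.
have tW1 : test (ev W1) by exact: t.
have tW2 : test (ev W2) by exact: t.
have tAS : test (ev (Add A sosJ)) by exact: t.
have S0 : 0 <= integral2 (ev sosJ).
  apply: integral2_ge0 => p; rewrite /sosJ /Sq.
  move: (Add (Eul (Eul uJ)) (Opp (Eul uJ))) (Add (Jac (Eul uJ)) (Opp (Jac uJ))) => a b.
  move: (Add (Eul uJ) (Opp uJ)) (Add uJ (Jac (Jac uJ))) => c d /=.
  rewrite -!expr2; apply: mulr_ge0; first exact: sqr_ge0.
  have pos n (x : R) : 0 <= n%:R * x ^+ 2 by apply: mulr_ge0; rewrite ?sqr_ge0.
  by rewrite addr_ge0 ?pos// addr_ge0 ?pos// addr_ge0 ?sqr_ge0.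
move: key.
rewrite -[X in integral2 X = _]/(fun p => ev (Mul (Mul bilapJ uJ) Log) p + ev W1 p).
rewrite -[X in _ = integral2 X]/(fun p => ev (Add A sosJ) p + ev W2 p).
rewrite !integral2D//.
move: wir S0.
move: (integral2 (ev (Mul (Mul bilapJ uJ) Log))) (integral2 (ev W1)) (integral2 (ev W2)).
by move: (integral2 (ev sosJ)) => s l w1 w2; move: (integral2 (ev A)) => a; lra.
Qed.

End identity.

(** * From complex-valued to real functions *)

Lemma Re_mul_conj (R : rcfType) (z w : R[i]) (c : R) :
  complex.Re (z * conjc w * c%:C) =
  complex.Re z * complex.Re w * c + complex.Im z * complex.Im w * c.
Proof. by case: z w => [x y] [x' y'] /=; ring. Qed.

Section complex_parts.
Context {R : realType}.
Variable u : R * R -> R[i].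
Hypothesis hu : test_function (~` [set (0 : R * R)]) u.

Let a p := complex.Re (u p).
Let b p := complex.Im (u p).

(** The closed support misses the origin, hence a ball around it, and is bounded because it is
    compact. *)
Lemma test_function_vanishes : exists d M : R, [/\ 0 < d,
  vanishes d M (fun p => complex.Re (u p)) & vanishes d M (fun p => complex.Im (u p))].
Proof.
have [_ cu u0] := hu.
have /compact_bounded[M [_ uM]] := cu.
have : nbhs (0 : R * R) (~` supp u).
  apply: open_nbhs_nbhs; split; first exact/closed_openC/closed_closure.
  by move=> /u0; apply.
move=> /nbhs_ballP[d /= d0 du].
have zero p : off_annulus d (`|M| + 1) p -> u p = 0.
  move=> pdM; apply/eqP; apply: contrapT => /negP up.
  have sp : supp u p by exact: subset_closure.
  case: pdM => [pd|Mp].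
    by apply: (du p) => //; rewrite -ball_normE /ball_/= sub0r normrN.
  have := uM (`|M| + 1) _ p sp.
  by rewrite /= leNgt Mp => /(_ _)/negP; apply => //; rewrite ltr_pwDr// ler_norm.
by exists d, (`|M| + 1); split=> // p /zero ->.
Qed.

Lemma test_function_Re : test (fun p => complex.Re (u p)).
Proof.
have [d [M [d0 a0 _]]] := test_function_vanishes; split; last by exists d, M.
by apply: (smooth_punctured d0 a0) => k; have [/(_ k)[]] := hu.
Qed.

Lemma test_function_Im : test (fun p => complex.Im (u p)).
Proof.
have [d [M [d0 _ b0]]] := test_function_vanishes; split; last by exists d, M.
by apply: (smooth_punctured d0 b0) => k; have [/(_ k)[]] := hu.
Qed.

Lemma sqr_normc (z : R[i]) :
  ComplexField.Normc.normc z ^+ 2 = complex.Re z ^+ 2 + complex.Im z ^+ 2.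
Proof. by case: z => x y; rewrite /= sqr_sqrtr// addr_ge0 ?sqr_ge0. Qed.

Lemma sq_hessian_eval p : sq_hessian u p =
  eval (fun p => complex.Re (u p)) 1 hessJ p + eval (fun p => complex.Im (u p)) 1 hessJ p.
Proof.
have [sa _] := test_function_Re; have [sb _] := test_function_Im.
(* [sq_hessian] differentiates along [e1] first, [jet] along [e2] first. *)
have mixa : 'D_e2 (fun x => 'D_e1 a x) p = jet a 1 1 p by exact: mixed_partials.
have mixb : 'D_e2 (fun x => 'D_e1 b x) p = jet b 1 1 p by exact: mixed_partials.
have hessE c : eval c 1 hessJ p =
    jet c 2 0 p ^+ 2 + 2 * jet c 1 1 p ^+ 2 + jet c 0 2 p ^+ 2.
  rewrite /hessJ /Sq.
  rewrite -[LHS]/(jet c 2 0 p * jet c 2 0 p + (2 * (jet c 1 1 p * jet c 1 1 p) +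
    jet c 0 2 p * jet c 0 2 p)).
  by move: (jet c 2 0 p) (jet c 1 1 p) (jet c 0 2 p) => *; ring.
have sumE (x y z x' y' z' : R) : x = x' -> y = y' -> z = z' ->
  x + 2 * y + z = x' + 2 * y' + z' by move=> -> -> ->.
transitivity (jet a 2 0 p ^+ 2 + jet b 2 0 p ^+ 2 +
  2 * (('D_e2 (fun x => 'D_e1 a x) p) ^+ 2 + ('D_e2 (fun x => 'D_e1 b x) p) ^+ 2) +
  (jet a 0 2 p ^+ 2 + jet b 0 2 p ^+ 2)).
  exact: (sumE _ _ _ _ _ _ (sqr_normc (partial e1 (partial e1 u) p))
    (sqr_normc (partial e2 (partial e1 u) p)) (sqr_normc (partial e2 (partial e2 u) p))).
transitivity (eval a 1 hessJ p + eval b 1 hessJ p); last by [].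
rewrite mixa mixb (hessE a) (hessE b).
move: (jet a 2 0 p) (jet a 1 1 p) (jet a 0 2 p) (jet b 2 0 p) (jet b 1 1 p) (jet b 0 2 p).
by move=> *; ring.
Qed.

Lemma bilaplacian_eval p : bilaplacian u p =
  eval (fun p => complex.Re (u p)) 1 bilapJ p +i* eval (fun p => complex.Im (u p)) 1 bilapJ p.
Proof.
have ta := test_function_Re; have tb := test_function_Im.
have e1E f e : test f -> ideal e -> (fun p => 'D_e1 (eval f 1 e) p) = eval f 1 (d1 e).
  by move=> tf; exact: derive1_eval.
have e2E f e : test f -> ideal e -> (fun p => 'D_e2 (eval f 1 e) p) = eval f 1 (d2 e).
  by move=> tf; exact: derive2_eval.
rewrite -[RHS]/((eval (fun p => complex.Re (u p)) 1 (d1 (d1 lapJ)) p +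
    eval (fun p => complex.Re (u p)) 1 (d2 (d2 lapJ)) p) +i*
  (eval (fun p => complex.Im (u p)) 1 (d1 (d1 lapJ)) p +
    eval (fun p => complex.Im (u p)) 1 (d2 (d2 lapJ)) p)).
by rewrite -!e1E// -!e2E.
Qed.

End complex_parts.

Theorem theorem2 (R : realType) (u : R * R -> R[i])
    (hu : test_function (~` [set (0 : R * R)]) u) :
  integral2 (fun x : R * R => sq_hessian u x * ln ((expR 2 * enorm x)^-1))
  <= complex.Re (cintegral2 (fun x : R * R =>
       bilaplacian u x * conjc (u x) * (ln ((enorm x)^-1))%:C)).
Proof.
have ta := test_function_Re hu; have tb := test_function_Im hu.
pose a p := complex.Re (u p); pose b p := complex.Im (u p).
pose lhs : expr R := Mul hessJ (Add Log (Cst (-2))).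
pose rhs : expr R := Mul (Mul bilapJ uJ) Log.
have t f e : test f -> ideal e -> test (eval f 1 e) by move=> tf; exact: test_eval.
have -> : (fun x => sq_hessian u x * ln ((expR 2 * enorm x)^-1)) =
    (fun x => eval a 1 lhs x + eval b 1 lhs x).
  apply/funext => p; rewrite (sq_hessian_eval hu).
  rewrite -[RHS]/(eval a 1 hessJ p * (logw p + -2) + eval b 1 hessJ p * (logw p + -2)).
  (* At the origin both logarithms are [ln 0 = 0] and do not differ by 2, but there the Hessian
     vanishes. *)
  have [->|p0] := eqVneq p 0; last by rewrite ln_expR2_enorm// mulrDl.
  by rewrite !eval_ideal0// addr0 !mul0r addr0.
rewrite [leRHS]/=.
have -> : (fun x => complex.Re (bilaplacian u x * conjc (u x) * (ln ((enorm x)^-1))%:C)) =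
    (fun x => eval a 1 rhs x + eval b 1 rhs x).
  apply/funext => p; rewrite (bilaplacian_eval hu).
  rewrite -[RHS]/(eval a 1 bilapJ p * a p * logw p + eval b 1 bilapJ p * b p * logw p).
  exact: Re_mul_conj.
rewrite !integral2D; [|exact: t..].
by apply: lerD; exact: real_inequality.
Qed.
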